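(* There is an absolute constant $c>0$ and a deterministic LOCAL algorithm with the following property. Let $H=(V,E)$ be a hypergraph of rank at most $r$ and maximum degree at most $\Delta$, with an edge-weighting $a:E\to[0,\infty)$. Suppose the algorithm is also given a good coloring of $H$. Then it runs in $\tilde O(r\log\Delta+\log^2\Delta)$ rounds and outputs a matching $M$ of $H$ with $a(M)\ge c\,a^*(H)/r$. If no good coloring is given, the same guarantee holds with round complexity $\tilde O(r\log\Delta+\log^2\Delta+\log^* n)$.
   Context: **Hypergraph notation.** For a hypergraph $H=(V,E)$: - $E$ may be a multiset. - $N(v)$ is the set of edges containing vertex $v$, and $\deg(v)=|N(v)|$. - The rank is the maximum edge size. - A matching is a set of pairwise disjoint edges. **Weights.** An edge-weighting is a function $a:E\to[0,\infty)$, and for $L\subseteq E$ we write $a(L)=\sum_{e\in L}a(e)$. **Fractional matchings.** A fractional matching is a function $h:E\to[0,1]$ with $\sum_{e\in N(v)}h(e)\le 1$ for all $v$. Its weight is $a(h)=\sum_e a(e)h(e)$. Then $a^*(H)$ denotes the maximum of $a(h)$ over all fractional matchings $h$. **LOCAL model on hypergraphs.** The incidence graph $\mathrm{Inc}(H)$ is the bipartite graph with one node per vertex of $H$ and one node per edge of $H$, where the node of $v$ is adjacent to the node of $e$ iff $v\in e$. Computation proceeds in synchronous rounds: - In each round, every node of $\mathrm{Inc}(H)$ may do unbounded local computation and send messages of unbounded size to its neighbours in $\mathrm{Inc}(H)$. - In the deterministic variant, nodes have unique $O(\log n)$-bit IDs. - Global upper bounds $n\ge|V|$, $\Delta\ge\max_v\deg(v)$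 and $r\ge\max_e|e|$ (with $r\ge2$) are known to all nodes. - At the end, each node outputs its part of the solution; for example, each edge outputs whether it is in $M$. **Good coloring.** A good coloring of $H$ is a proper vertex coloring of $\mathrm{Inc}(H)^2$ using $\mathrm{poly}(r,\Delta)$ colors. Here $G^2$ is the graph on the same node set with $u,v$ adjacent iff their distance in $G$ is at most 2. **Notation.** $\tilde O(x)$ denotes $x\cdot\mathrm{polylog}(x)$. *)

(* Defs.v *)
From Stdlib Require Import Reals.
From mathcomp Require Import all_boot.
Set Implicit Arguments. Unset Strict Implicit. Unset Printing Implicit Defensive.

(* A hypergraph with vertex type V and edge type E (edges may repeat:
   inc need not be injective, so E is a multiset of edges). *)
Section Hyper.
Variables (V E : finType) (inc : E -> {set V}).

Definition N_of (v : V) : {set E} := [set e | v \in inc e].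
Definition deg (v : V) : nat := #|N_of v|.

Definition rank_le (r : nat) : Prop := forall e, #|inc e| <= r.
Definition maxdeg_le (D : nat) : Prop := forall v, deg v <= D.

Definition is_matching (M : {set E}) : Prop :=
  forall e1 e2, e1 \in M -> e2 \in M -> e1 != e2 -> [disjoint inc e1 & inc e2].

Definition weight_set (a : E -> R) (L : {set E}) : R :=
  \big[Rplus/R0]_(e in L) a e.

Definition is_frac_matching (h : E -> R) : Prop :=
  (forall e, Rle R0 (h e) /\ Rle (h e) R1) /\
  (forall v, Rle (\big[Rplus/R0]_(e in N_of v) h e) R1).

Definition weight_frac (a h : E -> R) : R :=
  \big[Rplus/R0]_(e : E) (Rmult (a e) (h e)).

Definition inc_adj (x y : V + E) : bool :=
  match x, y with
  | inl v, inr e => v \in inc e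
  | inr e, inl v => v \in inc e
  | _, _ => false
  end.

Definition dist_le2 (x y : V + E) : bool :=
  (x != y) && (inc_adj x y || [exists z, inc_adj x z && inc_adj z y]).

(* Good coloring: proper coloring of Inc(H)^2 with poly(r,Delta) colours,
   here: colours in [0, (r + Delta)^kappa). *)
Definition good_coloring (kappa r D : nat) (col : V + E -> nat) : Prop :=
  (forall x, col x < (r + D) ^ kappa) /\
  (forall x y, dist_le2 x y -> col x != col y).
End Hyper.

Record NodeInput := {
  ni_id : nat;
  ni_n : nat;
  ni_Delta : nat;
  ni_r : nat;
  ni_is_edge : bool;
  ni_weight : R;          (* a(e) for edge nodes, 0 for vertex nodes *)
  ni_color : option nat
}.

(* A LOCAL algorithm: arbitrary state space, unbounded local computation;
   in each round a node updates its state from its own state and the states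
   of all its neighbours (messages of unbounded size), listed by increasing ID.
   [rounds n Delta r] is the number of rounds it runs. *)
Record LocalAlgo := {
  la_state : Type;
  la_init : NodeInput -> la_state;
  la_step : la_state -> seq la_state -> la_state;
  la_out : la_state -> bool;
  la_rounds : nat -> nat -> nat -> nat
}.

Section Run.
Variables (V E : finType) (inc : E -> {set V}).
Variable (A : LocalAlgo).
Variable (input : V + E -> NodeInput).
Variable (id : V + E -> nat).

Definition nbrs (x : V + E) : seq (V + E) :=
  sort (fun y z => id y <= id z) (enum [pred y | inc_adj inc x y]).

Fixpoint run_state (t : nat) : V + E -> la_state A :=
  match t with
  | 0 => fun x => @la_init A (input x)
  | t'.+1 => fun x => @la_step A (run_state t' x) [seq run_state t' y | y <- nbrs x]
  end.

Definition run_output (T : nat) : {set E} :=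
  [set e | @la_out A (run_state T (inr e))].
End Run.

Definition mk_input (V E : finType) (inc : E -> {set V}) (a : E -> R)
  (n D r : nat) (id : V + E -> nat) (col : option (V + E -> nat))
  (x : V + E) : NodeInput :=
  {| ni_id := id x; ni_n := n; ni_Delta := D; ni_r := r;
     ni_is_edge := (if x is inr _ then true else false);
     ni_weight := (match x with inr e => a e | inl _ => R0 end);
     ni_color := (match col with Some f => Some (f x) | None => None end) |}.

(* lg x = floor(log2 x) + 1 (>= 1, avoids degenerate log 0) *)
Definition lg (x : nat) : nat := (trunc_log 2 x).+1.

Fixpoint logstar_aux (fuel x : nat) : nat :=
  match fuel with
  | 0 => 0
  | f.+1 => if x <= 1 then 0 else (logstar_aux f (trunc_log 2 x)).+1
  end.
Definition logstar (x : nat) : nat := logstar_aux x x.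

Definition softO_le (C k t x : nat) : Prop := t <= C * x * (lg x) ^ k.

(* Hypotheses on an instance. IDs: unique, O(log n) bits, i.e. below
   (n+1)(Delta+1) raised to kappa (the number of Inc nodes is <= n(Delta+1)). *)
Definition valid_instance (kappa : nat) (V E : finType) (inc : E -> {set V})
  (a : E -> R) (n D r : nat) (id : V + E -> nat) : Prop :=
  2 <= r /\ #|V| <= n /\ rank_le inc r /\ maxdeg_le inc D /\
  (forall e, Rle R0 (a e)) /\ injective id /\
  (forall x, id x < (n.+1 * D.+1) ^ kappa).

(* The output M is a matching with a(M) >= c a*(H)/r, where a*(H) is the
   maximum of a(h) over fractional matchings h; stated as a(M) >= c a(h)/r
   for every fractional matching h. *)
Definition good_output (c : R) (V E : finType) (inc : E -> {set V})
  (a : E -> R) (r : nat) (M : {set E}) : Prop :=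
  is_matching inc M /\
  (forall h, is_frac_matching inc h ->
     Rle (Rdiv (Rmult c (weight_frac a h)) (INR r)) (weight_set a M)).

(* Main.v *)
Require Import Defs.
From Stdlib Require Import Reals.
From mathcomp Require Import all_boot.
From mathcomp Require Import all_order all_algebra all_field.
From mathcomp Require Import boolp Rstruct.
From mathcomp Require Import ring lra zify.

(** Put J = lg r + lg D.  A multiplicative-weights process with O(J^2) steps
    yields a fractional matching h of weight within a constant factor of optimal:
    edges that are too short for the current vertex lengths z grow geometrically,
    the lengths z react to the load and decay slowly, and since no edge can grow
    for more than half of the time, the time average of z is, up to a factor 2, a
    feasible dual solution.

    Scaling h by 1/(8r) gives x for which a(x) minus four times the total
    conflict cost \sum min(a e, a f) x_e x_f is Omega(a(h)/r).  All the nonzero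
    x_e are raised to at least 1 in O(J) stages; in a stage, every edge below the
    current threshold is either doubled or dropped, according to the sign of the
    gradient of the potential a(x) - k cost(x).  Edges that decide simultaneously
    lose at most the conflict cost inside their class, so a defective colouring
    with O(J) classes and an O(1/J) fraction of monochromatic cost suffices per
    stage.  It comes from polynomials over GF(2^m): edges first choose the
    evaluation point with least collision cost, which leaves poly(J) colours, and
    then, for points t = 0, 1, ..., an edge adopts the value of its polynomial at
    t as final colour as soon as the collision cost at t is at most average.
    Finally, among the surviving edges the local maxima of (a, id) are kept.

    Without a good colouring, the identifiers are reduced to poly(r, D) colours by
    log^* n steps of Linial's scheme, which uses the same polynomials.  The output
    of every step is a function of the radius-T view of an edge in Inc(H), hence
    computed by the algorithm that gathers views. *)

Set Implicit Arguments. Unset Strict Implicit. Unset Printing Implicit Defensive.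
Import Order.TTheory GRing.Theory Num.Theory.
Local Open Scope ring_scope.

(** * Fractional matchings by multiplicative weights *)

Lemma exchange_incidence (R : nmodType) (V E : finType) (inc : E -> {set V})
    (F : V -> E -> R) :
  \sum_v \sum_(e | v \in inc e) F v e = \sum_e \sum_(v in inc e) F v e.
Proof. by rewrite (exchange_big_dep xpredT). Qed.

Section MultiplicativeWeights.
Variables (R : realFieldType) (V E : finType) (inc : E -> {set V}) (a : E -> R).
Variables (K Dl bt gm : R).

Definition mwu_active (z : V -> R) (e : E) : bool := \sum_(v in inc e) z v < a e.

Definition mwu_step (s : (E -> R) * (V -> R)) : (E -> R) * (V -> R) :=
  let up e := if mwu_active s.2 e then s.1 e else 0 in
  (fun e => s.1 e + bt * up e,
   fun v => (1 - gm) * s.2 v * (1 + bt * \sum_(e | v \in inc e) up e)).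

(** The lengths start so that [K * z 0 v] dominates every weight at [v], while for [K = r * Dl]
    their total is at most the initial primal value. *)
Definition mwu_init : (E -> R) * (V -> R) :=
  (fun _ => Dl^-1, fun v => (\sum_(e | v \in inc e) a e) / K).

Definition mwu (t : nat) := iter t mwu_step mwu_init.

Lemma mwuS t : mwu t.+1 = mwu_step (mwu t). Proof. by []. Qed.

Let h t := (mwu t).1.
Let z t := (mwu t).2.
Let up t e := if mwu_active (z t) e then h t e else 0.
Let lam t v := \sum_(e | v \in inc e) h t e.
Let P t := \sum_e a e * h t e.
Let D t := \sum_v z t v.
Let del t v := bt * \sum_(e | v \in inc e) up t e.

Hypothesis a_ge0 : forall e, 0 <= a e.
Hypothesis a_empty : forall e, inc e = set0 -> a e = 0.
Hypothesis K_gt0 : 0 < K.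
Hypothesis Dl_gt0 : 0 < Dl.
Hypothesis bt_gt0 : 0 < bt.
Hypothesis gm_gt0 : 0 < gm.
Hypothesis gm_lt1 : gm < 1.

Let hS t e : h t.+1 e = h t e + bt * up t e. Proof. by []. Qed.
Let zS t v : z t.+1 v = (1 - gm) * z t v * (1 + del t v). Proof. by []. Qed.

Lemma mwu_h_gt0 t e : 0 < (mwu t).1 e.
Proof.
rewrite -/(h t e); elim: t => [|t IH]; first by rewrite /h /= invr_gt0.
rewrite hS ltr_wpDr // mulr_ge0 ?(ltW bt_gt0) // /up; case: ifP => // _; exact: ltW.
Qed.

Lemma mwu_h_ge t e : Dl^-1 <= (mwu t).1 e.
Proof.
rewrite -/(h t e); elim: t => [|t IH] //.
rewrite hS (le_trans IH) // lerDl mulr_ge0 ?(ltW bt_gt0) // /up.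
by case: ifP => // _; apply/ltW/mwu_h_gt0.
Qed.

Let up_ge0 t e : 0 <= up t e.
Proof. by rewrite /up; case: ifP => // _; apply/ltW/mwu_h_gt0. Qed.

Let del_ge0 t v : 0 <= del t v.
Proof. by apply: mulr_ge0; [exact: ltW | apply: sumr_ge0]. Qed.

Let z_ge0 t v : 0 <= z t v.
Proof.
elim: t => [|t IH]; first by rewrite /z /= divr_ge0 ?(ltW K_gt0) ?sumr_ge0.
rewrite zS; apply: mulr_ge0; last by rewrite addr_ge0.
by apply: mulr_ge0 => //; rewrite subr_ge0 ltW.
Qed.

Let D_ge0 t : 0 <= D t. Proof. exact: sumr_ge0. Qed.

(** Swapping sums turns the growth [X] of the total length into a sum over active edges of their
    increment times their length. An active edge is shorter than its weight, so the primal gain pays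
    for [X]; the decay term is profit. *)
Let primal_increment t : D t.+1 - D t + gm * D t <= P t.+1 - P t.
Proof.
have -> : P t.+1 - P t = \sum_e bt * (a e * up t e).
  rewrite -sumrB; apply: eq_bigr => e _; rewrite hS; ring.
set X := \sum_v z t v * del t v.
have -> : D t.+1 = (1 - gm) * (D t + X).
  rewrite /D /X -big_split mulr_sumr; apply: eq_bigr => v _; rewrite zS /=; ring.
have X0 : 0 <= X by apply: sumr_ge0 => v _; apply: mulr_ge0.
suff XP : X <= \sum_e bt * (a e * up t e).
  have : 0 <= gm * X by rewrite mulr_ge0 // ltW.
  lra.
have -> : X = \sum_e bt * (up t e * \sum_(v in inc e) z t v).
  rewrite /X (eq_bigr (fun v => \sum_(e | v \in inc e) bt * (up t e * z t v))).
    rewrite exchange_incidence; apply: eq_bigr => e _.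
    by rewrite !mulr_sumr.
  by move=> v _; rewrite /del !mulr_sumr; apply: eq_bigr => e _; ring.
apply: ler_sum => e _; rewrite ler_wpM2l ?(ltW bt_gt0) // /up.
case: ifP => [ac|_]; last by rewrite mul0r mulr0.
by rewrite mulrC ler_wpM2r ?(ltW (mwu_h_gt0 _ _)) // ltW.
Qed.

Let primal_sum t : P 0 - D 0 + D t + gm * \sum_(s < t) D s <= P t.
Proof.
elim: t => [|t IH]; first by rewrite big_ord0 mulr0; lra.
rewrite big_ord_recr /= mulrDr; have := primal_increment t; lra.
Qed.

(* Piecewise linear interpolation of 2^(x/2): if x = 2k + u with 0 <= u < 2,
   then the product of the factors 1 + delta with sum x is at least
   2^k (1 + u/2); this replaces the bound 1 + x >= exp (x/2). *)
Let growth (k : nat) (u d : R) :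
  0 <= u < 2 -> 0 <= d <= 1 ->
  exists (k' : nat) (u' : R), [/\ 0 <= u' < 2, 2 *+ k + u + d = 2 *+ k' + u' &
    2 ^+ k' * (1 + u' / 2) <= 2 ^+ k * (1 + u / 2) * (1 + d)].
Proof.
move=> /andP[u0 u2] /andP[d0 d1].
have pw : 0 <= (2 : R) ^+ k by rewrite exprn_ge0.
case: (ltP (u + d) 2) => ud.
- exists k, (u + d); split; [lra | ring |].
  rewrite -mulrA ler_wpM2l //.
  have : 0 <= u * d by rewrite mulr_ge0.
  lra.
- exists k.+1, (u + d - 2); split; [lra | rewrite mulrS; ring |].
  have -> : 2 ^+ k.+1 * (1 + (u + d - 2) / 2) = 2 ^+ k * (u + d) :> R.
    by rewrite exprS; field.
  rewrite -mulrA ler_wpM2l //.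
  have : 0 <= u * d by rewrite mulr_ge0.
  lra.
Qed.

Variables (T N : nat).
Hypothesis decay : forall t, (t <= T)%N -> K < 2 ^+ N * (1 - gm) ^+ t.
Hypothesis bt_bound : bt * (2 *+ N + 4) <= 1.
Hypothesis lam0 : forall v, (\sum_(e | v \in inc e) 1 : R) <= Dl.

(** Apart from decay, the length of a vertex grows exponentially in its load. Once the load is near
    [2 *+ N], the length exceeds every incident weight and the load stops growing. *)
Let load_invariant t v : (t <= T)%N ->
  lam t v <= 2 *+ N + 4 /\
  exists (k : nat) (u : R), [/\ 0 <= u < 2, lam t v <= 1 + (2 *+ k + u) &
    z 0 v * (1 - gm) ^+ t * (2 ^+ k * (1 + u / 2)) <= z t v].
Proof.
have l0 : lam 0 v <= 1.
  rewrite /lam /h /= (eq_bigr (fun _ => 1 * Dl^-1)) => [|e _]; last by rewrite mul1r.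
  by rewrite -mulr_suml ler_pdivrMr // mul1r.
elim: t => [|t IH] tT.
  split; first by apply: le_trans l0 _; rewrite -[1]add0r lerD ?mulrn_wge0 //; lra.
  exists 0%N, 0; split => //; [lra | by rewrite mulr0n !addr0 |].
  by rewrite expr0 mulr1 expr0 mul0r addr0 !mulr1.
have [lamt [k [u [u02 lamk zk]]]] := IH (ltnW tT).
have lamS : lam t.+1 v = lam t v + del t v.
  rewrite /lam /del mulr_sumr -big_split; apply: eq_bigr => e _; exact: hS.
have uple : \sum_(e | v \in inc e) up t e <= lam t v.
  by apply: ler_sum => e _; rewrite /up; case: ifP => // _; apply/ltW/mwu_h_gt0.
have del1 : del t v <= 1.
  apply: le_trans bt_bound; rewrite /del ler_wpM2l ?(ltW bt_gt0) //; exact: le_trans lamt.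
have [k' [u' [u02' eqk growk]]] :=
  @growth k u (del t v) u02 (introT andP (conj (del_ge0 t v) del1)).
have inv : exists (k : nat) (u : R), [/\ 0 <= u < 2, lam t.+1 v <= 1 + (2 *+ k + u) &
    z 0 v * (1 - gm) ^+ t.+1 * (2 ^+ k * (1 + u / 2)) <= z t.+1 v].
  exists k', u'; split=> //; first by rewrite lamS -eqk; lra.
  rewrite zS exprS.
  have g0 : 0 <= 1 - gm by rewrite subr_ge0 ltW.
  apply: le_trans (_ : z 0 v * ((1 - gm) * (1 - gm) ^+ t) *
    (2 ^+ k * (1 + u / 2) * (1 + del t v)) <= _).
    by rewrite ler_wpM2l // mulr_ge0 ?z_ge0 // mulr_ge0 ?exprn_ge0.
  rewrite (_ : (1 - gm) * z t v * _ = (1 - gm) * (z t v * (1 + del t v))); last by rewrite mulrA.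
  have -> : z 0 v * ((1 - gm) * (1 - gm) ^+ t) * (2 ^+ k * (1 + u / 2) * (1 + del t v)) =
    (1 - gm) * (z 0 v * (1 - gm) ^+ t * (2 ^+ k * (1 + u / 2)) * (1 + del t v)) by ring.
  by rewrite ler_wpM2l // ler_wpM2r // addr_ge0.
split; last exact: inv.
(* Without an active edge at [v] the load is unchanged. Otherwise the length of [v] is below
   [K * z 0 v], which forces [k < N] and leaves room for one more increment. *)
case: (boolP [exists e, (v \in inc e) && mwu_active (z t) e]); last first.
  rewrite negb_exists => /forallP noact.
  rewrite lamS (_ : del t v = 0) ?addr0 // /del big1 ?mulr0 // => e ve.
  by rewrite /up; have := noact e; rewrite ve /= => /negbTE ->.
case/existsP => e /andP[ve]; rewrite /mwu_active => ac.
have zva : z t v < a e.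
  apply: le_lt_trans ac; rewrite (bigD1 v) //= lerDl; exact: sumr_ge0.
have az : a e <= z 0 v * K.
  rewrite /z /= divfK ?gt_eqF // (bigD1 e) //= lerDl; exact: sumr_ge0.
have zk' : z 0 v * ((1 - gm) ^+ t * 2 ^+ k) < z 0 v * K.
  apply: lt_le_trans az; apply: le_lt_trans zva; apply: le_trans zk.
  rewrite -mulrA ler_wpM2l // ler_wpM2l ?exprn_ge0 ?subr_ge0 ?(ltW gm_lt1) //.
  by rewrite ler_peMr ?exprn_ge0 //; lra.
have z0 : 0 < z 0 v.
  by rewrite lt_neqAle z_ge0 andbT eq_sym; apply/eqP => z00; move: zk'; rewrite z00 !mul0r ltxx.
have kN : (k < N)%N.
  rewrite ltnNge; apply/negP => Nk.
  move: zk'; rewrite ltr_pM2l // => /lt_trans/(_ (decay (ltnW tT))).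
  rewrite mulrC ltr_pM2r ?exprn_gt0 ?subr_gt0 //.
  by rewrite ltr_eXn2l ?ltr1n // ltnNge Nk.
rewrite lamS; apply: le_trans (lerD lamk del1) _.
have : 2 *+ k.+1 <= (2 : R) *+ N by rewrite ler_pMn2l.
rewrite mulrS; lra.
Qed.

Lemma mwu_load v : \sum_(e | v \in inc e) (mwu T).1 e <= 2 *+ N + 4.
Proof. by case: (@load_invariant T v (leqnn T)). Qed.

Let nact t e := (\sum_(s < t) mwu_active (z s) e)%N.

Let h_nact t e : h t e = (1 + bt) ^+ nact t e / Dl.
Proof.
elim: t => [|t IH]; first by rewrite /nact big_ord0 expr0 mul1r.
rewrite hS /nact big_ord_recr /= -/(nact t e) /up; case: ifP => _.
  by rewrite addn1 exprS IH; ring.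
by rewrite addn0 mulr0 addr0.
Qed.

Variable half : nat.
Hypothesis T_half : (T = half.*2)%N.
Hypothesis act_bound : (2 *+ N + 4) * Dl < (1 + bt) ^+ half.
Hypothesis a_cap : Dl * (\sum_v z 0 v) <= \sum_e a e.

(** Each active step multiplies [h] by [1 + bt], so more than [half] of them would break the load
    bound at a vertex of [e]; positive weight ensures that [e] has one. *)
Let nact_le e : 0 < a e -> (nact T e <= half)%N.
Proof.
move=> ae; have [v ve] : exists v, v \in inc e.
  by apply/set0Pn/eqP => /a_empty ae0; rewrite ae0 ltxx in ae.
rewrite leqNgt; apply/negP => hn.
have := mwu_load v; rewrite leNgt => /negP; apply.
apply: lt_le_trans (_ : h T e <= _); last first.
  rewrite (bigD1 e) //= lerDl; apply: sumr_ge0 => f _; exact/ltW/mwu_h_gt0.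
rewrite h_nact ltr_pdivlMr //; apply: lt_le_trans act_bound _.
by rewrite ler_weXn2l ?(ltnW hn) // lerDl ltW.
Qed.

(** The primal value is at least [gm] times the sum of the dual totals over time. Each of these
    bounds the part of [g] on inactive edges by weak duality, and every edge of positive weight is
    inactive at least half of the time. *)
Lemma mwu_value (g : E -> R) : (forall e, 0 <= g e) ->
  (forall v, \sum_(e | v \in inc e) g e <= 1) ->
  gm * half%:R * \sum_e a e * g e <= \sum_e a e * (mwu T).1 e.
Proof.
move=> g0 g1; rewrite -/(P T).
have D0P : D 0 <= P 0.
  rewrite /P /h /= -mulr_suml ler_pdivlMr // mulrC; exact: a_cap.
apply: le_trans (primal_sum T).
suff : half%:R * \sum_e a e * g e <= \sum_(s < T) D s.
  move/(ler_wpM2l (ltW gm_gt0)); rewrite mulrA => H; have := D_ge0 T; lra.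
apply: le_trans (_ : \sum_(s < T) \sum_e a e * g e * (~~ mwu_active (z s) e)%:R <= _).
  rewrite exchange_big mulr_sumr; apply: ler_sum => e _ /=.
  rewrite -mulr_sumr mulrC.
  case: (ltgtP (a e) 0) => [|ae|->]; [by rewrite ltNge a_ge0 | | by rewrite !mul0r].
  rewrite ler_wpM2l ?mulr_ge0 // -natr_sum ler_nat.
  have sumT : (nact T e + \sum_(s < T) ~~ mwu_active (z s) e = T)%N.
    rewrite -big_split /= -[RHS](card_ord T) -sum1_card.
    by apply: eq_bigr => s _; case: mwu_active.
  rewrite -(leq_add2l (nact T e)) sumT; apply: leq_trans (_ : half + half <= T)%N.
    by rewrite leq_add2r nact_le.
  by rewrite addnn T_half.
apply: ler_sum => s _.
apply: le_trans (_ : \sum_e \sum_(v in inc e) g e * z s v <= _).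
  apply: ler_sum => e _; rewrite -mulr_sumr.
  case: (boolP (mwu_active (z s) e)) => ac; first by rewrite mulr0 mulr_ge0 // sumr_ge0.
  by rewrite mulr1 mulrC ler_wpM2l // leNgt.
rewrite -exchange_incidence; apply: ler_sum => v _.
by rewrite -mulr_suml ler_piMl.
Qed.

End MultiplicativeWeights.

Lemma bernoulli (R : realFieldType) (x : R) (n : nat) :
  -1 <= x -> 1 + x *+ n <= (1 + x) ^+ n.
Proof.
move=> x1; elim: n => [|n IH]; first by rewrite mulr0n expr0 addr0.
have x1' : 0 <= 1 + x by lra.
rewrite exprS; apply: le_trans (ler_wpM2l x1' IH).
have : 0 <= x ^+ 2 *+ n by rewrite mulrn_wge0 // sqr_ge0.
have -> : (1 + x) * (1 + x *+ n) = 1 + x *+ n.+1 + x ^+ 2 *+ n.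
  by rewrite mulrS -[x *+ n]mulr_natr -[_ ^+ 2 *+ n]mulr_natr; ring.
lra.
Qed.

(** * Choice of the parameters for multiplicative weights *)

Section FractionalMatching.
Variables (R : realFieldType) (V E : finType) (inc : E -> {set V}) (a : E -> R).
Variables (r D J : nat).
Hypothesis a_ge0 : forall e, 0 <= a e.
Hypothesis a_empty : forall e, inc e = set0 -> a e = 0.
Hypothesis J_gt0 : (0 < J)%N.
Hypothesis r_gt0 : (0 < r)%N.
Hypothesis rDJ : (r * D.+1 <= 2 ^ J)%N.
Hypothesis rank : forall e, (#|inc e| <= r)%N.
Hypothesis degree : forall v, (#|[set e | v \in inc e]| <= D)%N.

Definition mwu_time := (1200 * J * J)%N.
Definition mwu_output : E -> R :=
  (mwu inc a (r * D.+1)%:R D.+1%:R ((24 * J)%:R^-1) ((300 * J)%:R^-1) mwu_time).1.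

Let D_le : (D.+1 <= 2 ^ J)%N.
Proof. by apply: leq_trans rDJ; rewrite leq_pmull. Qed.

(** The running time splits into [8 * J] blocks of [150 * J] steps, and decay at rate
    [1 / (300 * J)] costs at most a factor 2 per block. *)
Let decay t : (t <= mwu_time)%N ->
  (r * D.+1)%:R < 2 ^+ (9 * J + 1) * (1 - (300 * J)%:R^-1) ^+ t :> R.
Proof.
move=> tT; set g : R := (300 * J)%:R^-1.
have g_gt0 : 0 < g by rewrite invr_gt0 ltr0n muln_gt0.
have g_inv : g * (300 * J)%:R = 1 by rewrite mulVf // pnatr_eq0 -lt0n muln_gt0.
have g_half : g *+ (150 * J) = 2^-1.
  have : g *+ (150 * J) *+ 2 = 1 by rewrite -mulrnA -mulr_natr -[RHS]g_inv; congr (_ * _%:R); lia.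
  rewrite mulr2n; lra.
have g_le1 : g <= 1 by rewrite invf_le1 ?ler1n ?ltr0n muln_gt0.
have low : 2^-1 <= (1 - g) ^+ (150 * J).
  have := @bernoulli R (- g) (150 * J); rewrite mulNrn g_half => H.
  apply: le_trans (H _); lra.
have lowT : (2 ^+ (8 * J))^-1 <= (1 - g) ^+ t.
  apply: le_trans (_ : (1 - g) ^+ mwu_time <= _); last first.
    by rewrite ler_wiXn2l //; lra.
  have -> : mwu_time = (150 * J * (8 * J))%N by rewrite /mwu_time; lia.
  by rewrite -exprVn [leRHS]exprM lerXn2r // nnegrE; lra.
apply: le_lt_trans (_ : 2 ^+ J < _); first by rewrite -natrX ler_nat.
have p0 : 0 < (2 : R) ^+ (9 * J + 1) by rewrite exprn_gt0.
apply: lt_le_trans (ler_wpM2l (ltW p0) lowT).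
have -> : (9 * J + 1 = J + 1 + 8 * J)%N by lia.
rewrite exprD mulfK ?expf_eq0 ?pnatr_eq0 ?andbF //.
by rewrite ltr_eXn2l ?ltr1n // addn1.
Qed.

Lemma mwu_output_ge e : D.+1%:R^-1 <= mwu_output e.
Proof. by apply: mwu_h_ge => //; rewrite ?ltr0n ?invr_gt0 ?ltr0n ?muln_gt0. Qed.

Let step_bound : (24 * J)%:R^-1 * (2 *+ (9 * J + 1) + 4) <= 1 :> R.
Proof.
rewrite mulrC ler_pdivrMr ?ltr0n ?muln_gt0 // mul1r -mulrnA -natrD ler_nat; lia.
Qed.

Lemma mwu_output_load v : \sum_(e | v \in inc e) mwu_output e <= (24 * J)%:R.
Proof.
apply: le_trans (_ : 2 *+ (9 * J + 1) + 4 <= _); last first.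
  by rewrite -mulrnA -natrD ler_nat; lia.
apply: mwu_load => //; rewrite ?ltr0n ?invr_gt0 ?ltr0n ?muln_gt0 ?r_gt0 //.
- by rewrite invf_lt1 ?ltr1n ?ltr0n; lia.
- by move=> w; rewrite sumr_const ler_nat leqW // -cardsE degree.
Qed.

(** The factor is [gm * half] with [half = 600 * J * J]. Against the load bound [24 * J], rescaling
    loses a factor 12. *)
Lemma mwu_output_value (g : E -> R) : (forall e, 0 <= g e) ->
  (forall v, \sum_(e | v \in inc e) g e <= 1) ->
  2 * J%:R * \sum_e a e * g e <= \sum_e a e * mwu_output e.
Proof.
move=> g0 g1.
have -> : 2 * J%:R = (300 * J)%:R^-1 * (600 * J * J)%:R :> R.
  apply: (mulfI (x := (300 * J)%:R)); first by rewrite pnatr_eq0; lia.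
  rewrite mulVKf ?pnatr_eq0; last by lia.
  by rewrite -!natrM; congr _%:R; lia.
apply: (@mwu_value R V E inc a (r * D.+1)%:R D.+1%:R _ _ _ _ _ _ _ _ _ mwu_time (9 * J + 1))
  => //; rewrite ?ltr0n ?invr_gt0 ?ltr0n ?muln_gt0 ?r_gt0 //.
- by rewrite invf_lt1 ?ltr1n ?ltr0n; lia.
- by move=> w; rewrite sumr_const ler_nat leqW // -cardsE degree.
- by rewrite /mwu_time; lia.
(* Every [24 * J] active steps at least double [h], so [half] of them gain [2 ^ (25 * J)], more than
   the load bound times [D.+1]. *)
- have -> : (600 * J * J = 24 * J * (25 * J))%N by lia.
  have b0 : 0 < (24 * J)%:R^-1 :> R by rewrite invr_gt0 ltr0n; lia.
  have two : 2 <= (1 + (24 * J)%:R^-1) ^+ (24 * J) :> R.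
    have := @bernoulli R (24 * J)%:R^-1 (24 * J).
    rewrite -[_^-1 *+ _]mulr_natr mulVf ?pnatr_eq0; last by lia.
    move=> H; apply: le_trans (H _); first by rewrite -[2]/(1 + 1).
    by apply: le_trans (ltW b0); lra.
  rewrite exprM; apply: lt_le_trans (_ : 2 ^+ (25 * J) <= _); last first.
    by apply: lerXn2r => //; rewrite nnegrE //; apply: le_trans two.
  rewrite -mulrnA -natrD -natrM -natrX ltr_nat.
  have -> : (25 * J = 24 * J + J)%N by lia.
  rewrite expnD; apply: leq_ltn_trans (leq_mul (leqnn _) D_le) _.
  rewrite ltn_pmul2r ?expn_gt0 //; apply: leq_ltn_trans (ltn_expl _ (ltnSn 1)); lia.
- rewrite -mulr_suml.
  have -> : \sum_v \sum_(e | v \in inc e) a e = \sum_e \sum_(v in inc e) a e.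
    exact: exchange_incidence.
  rewrite natrM invfM [_ * (_ * _)]mulrCA [D.+1%:R * _]mulrCA divff ?pnatr_eq0 // mulr1.
  rewrite ler_pdivrMr ?ltr0n //.
  rewrite mulr_suml; apply: ler_sum => e _.
  by rewrite sumr_const mulr_natr ler_wpMn2l.
Qed.

End FractionalMatching.

(** * Hash families from polynomials over GF(2^m) *)

Section RootCount.
Variable F : finFieldType.

Lemma card_roots_le (p : {poly F}) (d : nat) :
  p != 0 -> (size p <= d.+1)%N -> (#|[set t | root p t]| <= d)%N.
Proof.
move=> p0 sp; rewrite cardE.
have := @max_poly_roots F p (enum [set t | root p t]) p0.
rewrite enum_uniq => /(_ _ isT) H; rewrite -ltnS; apply: leq_trans sp; apply: H.
by apply/allP => t; rewrite mem_enum inE.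
Qed.

(** The leading monomial cancels in differences and, for positive [d], excludes constant
    polynomials, so that each value is taken at most [d] times. *)
Definition monic_of_row d (u : 'rV[F]_d) : {poly F} := 'X^d + rVpoly u.

Lemma agree_le d (u v : 'rV[F]_d) : u != v ->
  (#|[set t | (monic_of_row u).[t] == (monic_of_row v).[t]]| <= d)%N.
Proof.
move=> uv; have -> : [set t | (monic_of_row u).[t] == (monic_of_row v).[t]] =
    [set t | root (rVpoly (u - v)) t].
  apply/setP => t; rewrite !inE /root linearB /= !hornerE.
  by rewrite -subr_eq0 opprD addrACA subrr add0r.
apply: card_roots_le; last exact: leq_trans (size_poly _ _) _.
apply: contra_neq uv => p0; apply/eqP; rewrite -subr_eq0; apply/eqP.
by rewrite -[LHS]rVpolyK p0 linear0.
Qed.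

Lemma level_le d (u : 'rV[F]_d) (y : F) : (0 < d)%N ->
  (#|[set t | (monic_of_row u).[t] == y]| <= d)%N.
Proof.
move=> d0; have -> : [set t | (monic_of_row u).[t] == y] =
    [set t | root (monic_of_row u - y%:P) t].
  by apply/setP => t; rewrite !inE /root !hornerE subr_eq0.
have sz : size (monic_of_row u - y%:P) = d.+1.
  rewrite /monic_of_row -addrA size_polyDl size_polyXn // ltnS.
  apply: leq_trans (size_polyD _ _) _; rewrite geq_max size_poly size_polyN.
  by rewrite (leq_trans (size_polyC_leq1 _)).
by apply: card_roots_le; rewrite ?sz // -size_poly_gt0 sz.
Qed.

End RootCount.

(** A colour below [2 ^ (m * d)] names a coefficient vector over the field with [2 ^ m] elements.
    Larger colours fall back to the zero row, for which the second bound still holds. *)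
Lemma hash_family (m d : nat) : (0 < m)%N -> (0 < d)%N ->
  exists H : nat -> 'I_(2 ^ m).-1.+1 -> 'I_(2 ^ m).-1.+1,
    (forall c c', (c < 2 ^ (m * d))%N -> (c' < 2 ^ (m * d))%N -> c != c' ->
       (#|[set t | H c t == H c' t]| <= d)%N) /\
    (forall c y, (#|[set t | H c t == y]| <= d)%N).
Proof.
move=> m0 d0; have [F _ cF] := @pPrimePowerField 2 m isT m0.
have cE : (2 ^ m).-1.+1 = #|F| by rewrite prednK ?expn_gt0.
pose dec (t : 'I_(2 ^ m).-1.+1) : F := enum_val (cast_ord cE t).
pose enc (x : F) : 'I_(2 ^ m).-1.+1 := cast_ord (esym cE) (enum_rank x).
have encK : cancel enc dec by move=> x; rewrite /enc /dec cast_ordKV enum_rankK.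
have decK : cancel dec enc by move=> x; rewrite /enc /dec enum_valK cast_ordK.
pose row c : 'rV[F]_d := nth 0 (enum 'rV[F]_d) c.
exists (fun c t => enc (monic_of_row (row c)).[dec t]).
have trans (P : pred F) : #|[set t | P (dec t)]| = #|[set x | P x]|.
  rewrite -(card_imset _ (can_inj encK)); apply: eq_card => t.
  rewrite inE; apply/idP/imsetP => [Pt|[x Px ->]].
    by exists (dec t); rewrite ?inE ?decK.
  by rewrite encK; rewrite inE in Px.
split=> [c c' cd cd' cc'|c y].
- have sz : size (enum 'rV[F]_d) = (2 ^ (m * d))%N.
    by rewrite -cardE card_mx mul1n cF -expnM.
  have := @agree_le F d (row c) (row c'); rewrite nth_uniq ?sz ?enum_uniq // => /(_ cc').
  rewrite -(trans (fun x => (monic_of_row (row c)).[x] == (monic_of_row (row c')).[x])).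
  by apply: leq_trans; apply/subset_leq_card/subsetP => t; rewrite !inE (can_eq encK).
- have := @level_le F d (row c) (dec y) d0.
  rewrite -(trans (fun x => (monic_of_row (row c)).[x] == dec y)).
  by apply: leq_trans; apply/subset_leq_card/subsetP => t; rewrite !inE -(can_eq decK) encK.
Qed.

(** * Defective colouring *)

Section HashColouring.
Variables (R : realFieldType) (E : finType) (w : E -> E -> R).
Variables (Q : nat) (H : nat -> 'I_Q.+1 -> 'I_Q.+1) (c : E -> nat) (d : nat).

Definition hash_conflict (e : E) (t : 'I_Q.+1) : R :=
  \sum_f w e f * (H (c e) t == H (c f) t)%:R.

Definition hash_slot (e : E) : 'I_Q.+1 := [arg min_(t < ord0) hash_conflict e t]%O.

Definition hash_colour (e : E) : nat := (hash_slot e * Q.+1 + H (c e) (hash_slot e))%N.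

(* Some y once the final colour y has been fixed.  A slot is acceptable if its
   conflict is at most the average bound 2d/(Q+1) times the total weight: each
   neighbour collides in at most d slots while undecided and d slots afterwards. *)
Definition final_conflict (s : E -> option 'I_Q.+1) (e : E) (t : 'I_Q.+1) : R :=
  \sum_f w e f *
    ((s f == Some (H (c e) t)) || (s f == None) && (H (c f) t == H (c e) t))%:R.

Definition final_step (t : 'I_Q.+1) (s : E -> option 'I_Q.+1) (e : E) :=
  if s e is Some y then Some y
  else if Q.+1%:R * final_conflict s e t <= (2 * d)%:R * \sum_f w e f
       then Some (H (c e) t) else None.

Fixpoint final_colour (j : nat) : E -> option 'I_Q.+1 :=
  if j is i.+1 then final_step (inord i) (final_colour i) else fun _ => None.

Hypothesis w_ge0 : forall e f, 0 <= w e f.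
Hypothesis agree : forall e f, 0 < w e f ->
  (#|[set t | H (c e) t == H (c f) t]| <= d)%N.

Lemma hash_colour_lt e : (hash_colour e < Q.+1 * Q.+1)%N.
Proof.
rewrite /hash_colour; apply: leq_trans (_ : (hash_slot e).+1 * Q.+1 <= _)%N.
  by rewrite mulSn addnC ltn_add2r.
by rewrite leq_mul2r ltn_ord orbT.
Qed.

Lemma hash_colour_eq e f : hash_colour e = hash_colour f ->
  hash_slot e = hash_slot f /\
  H (c e) (hash_slot e) = H (c f) (hash_slot f).
Proof.
rewrite /hash_colour => ef.
have := congr1 (divn^~ Q.+1) ef; rewrite !divnMDl // !divn_small ?addn0 // => se.
have := congr1 (modn^~ Q.+1) ef; rewrite !modnMDl !modn_small // => he.
by split; apply: val_inj.
Qed.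

Let weighted_count (F : E -> 'I_Q.+1 -> bool) (b : nat) e :
  (forall f, 0 < w e f -> (#|[set t | F f t]| <= b)%N) ->
  \sum_t \sum_f w e f * (F f t)%:R <= b%:R * \sum_f w e f.
Proof.
move=> Fb; rewrite exchange_big mulr_sumr; apply: ler_sum => f _ /=.
rewrite -mulr_sumr -natr_sum mulrC.
have -> : (\sum_t F f t = #|[set t | F f t]|)%N.
  by rewrite -sum1dep_card [RHS]big_mkcond; apply: eq_bigr => t _; case: (F f t).
have := w_ge0 e f; rewrite le_eqVlt => /orP[/eqP <-|we]; first by rewrite !mulr0.
by rewrite ler_pM2r // ler_nat Fb.
Qed.

(** Equal colours collide in a common slot, so the defect is at most the conflict in the minimising
    slot, hence at most the average over slots. *)
Lemma hash_colour_defect e :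
  Q.+1%:R * \sum_f w e f * (hash_colour e == hash_colour f)%:R <= d%:R * \sum_f w e f.
Proof.
apply: le_trans (weighted_count (agree (e := e))).
rewrite -[Q.+1 in leLHS]card_ord mulr_natl -sumr_const; apply: ler_sum => t _.
apply: le_trans (_ : hash_conflict e (hash_slot e) <= _).
  apply: ler_sum => f _; rewrite ler_wpM2l // ler_nat.
  by case: eqP => // /hash_colour_eq[<- ->]; rewrite eqxx.
by rewrite /hash_slot; case: arg_minP => // i _; apply.
Qed.

Hypothesis level : forall e y, (#|[set t | H (c e) t == y]| <= d)%N.
Hypothesis w_sym : forall e f, w e f = w f e.

Let final_keep j k e y : final_colour j e = Some y -> final_colour (j + k) e = Some y.
Proof.
move=> jy; elim: k => [|k IH]; first by rewrite addn0.
by rewrite addnS /= /final_step IH.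
Qed.

Let final_keep_le j k e y : (j <= k)%N ->
  final_colour j e = Some y -> final_colour k e = Some y.
Proof. by move=> /subnKC <-; exact: final_keep. Qed.

(** An edge that never decides would have conflict above the threshold in every slot; summing over
    slots contradicts the count of bad slots per neighbour. *)
Let final_total e : final_colour Q.+1 e <> None.
Proof.
move=> eN; have noneT (t : 'I_Q.+1) : final_colour t e = None.
  case et: (final_colour t e) => [y|] //.
  by rewrite (final_keep_le (ltnW (ltn_ord t)) et) in eN.
have big (t : 'I_Q.+1) : (2 * d)%:R * (\sum_f w e f) < Q.+1%:R * final_conflict (final_colour t) e t.
  have: final_colour t.+1 e = None.
    case et: (final_colour t.+1 e) => [y|] //.
    by rewrite (final_keep_le (ltn_ord t) et) in eN.
  by rewrite /= /final_step noneT inord_val; case: leP.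
have : \sum_(t < Q.+1) (2 * d)%:R * (\sum_f w e f)
       < \sum_(t < Q.+1) Q.+1%:R * final_conflict (final_colour t) e t.
  apply: ltr_sum => //; apply/hasP; exists ord0 => //; exact: mem_index_enum.
rewrite sumr_const card_ord -[ltLHS]mulr_natl -mulr_sumr ltr_pM2l // ltNge => /negP; apply.
apply: weighted_count => f we; rewrite mul2n -addnn.
apply: leq_trans (_ : #|[set t : 'I_Q.+1 | final_colour t f == Some (H (c e) t)] :|:
  [set t | H (c f) t == H (c e) t]| <= _)%N.
  apply/subset_leq_card/subsetP => t; rewrite !inE => /orP[->//|/andP[_ ->]].
  by rewrite orbT.
apply: leq_trans (leq_card_setU _ _) _; apply: leq_add; last by rewrite agree // w_sym.
case fy: (final_colour Q.+1 f) => [y|].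
  apply: leq_trans (level e y); apply/subset_leq_card/subsetP => t; rewrite !inE.
  move=> /eqP/(final_keep_le (ltnW (ltn_ord t))); rewrite fy => -[->].
  exact: eqxx.
rewrite (_ : [set t | _] = set0) ?cards0 //; apply/setP => t; rewrite !inE.
apply/negP => /eqP/(final_keep_le (ltnW (ltn_ord t))); by rewrite fy.
Qed.

Lemma final_colour_some e : exists y, final_colour Q.+1 e = Some y.
Proof. by move: (@final_total e); case: final_colour => // y _; exists y. Qed.

(** A monochromatic pair is charged to the edge that decides later, whose conflict at that moment
    contains the other one; in a tie both see it. Allowing either order doubles [2 * d]. *)
Lemma final_colour_defect :
  Q.+1%:R * \sum_e \sum_f w e f * (final_colour Q.+1 e == final_colour Q.+1 f)%:R
    <= (4 * d)%:R * \sum_e \sum_f w e f.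
Proof.
(* [tau e] is the slot in which [e] decides. *)
have /fin_all_exists [tau tauP] e : exists t : 'I_Q.+1, final_colour t e = None /\
    final_colour t.+1 e <> None.
  have : exists j, final_colour j e != None by exists Q.+1; apply/eqP/final_total.
  move/ex_minnP => [[|j] jN jmin]; first by rewrite eqxx in jN.
  have jQ : (j < Q.+1)%N by apply: jmin; apply/eqP/final_total.
  exists (Ordinal jQ); split; last by apply/eqP.
  by apply/eqP; rewrite -[_ == _]negbK; apply/negP => /jmin; rewrite ltnn.
have tauE e : final_colour Q.+1 e = Some (H (c e) (tau e)) /\
    Q.+1%:R * final_conflict (final_colour (tau e)) e (tau e)
      <= (2 * d)%:R * \sum_f w e f.
  have [t0 t1] := tauP e.
  have : final_colour (tau e).+1 e <> None by [].
  rewrite /= /final_step t0 inord_val; case: ifP => // good _; split=> //.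
  apply: (final_keep_le (ltn_ord (tau e))).
  by rewrite /= /final_step t0 inord_val good.
pose S := \sum_e final_conflict (final_colour (tau e)) e (tau e).
have SW : Q.+1%:R * S <= (2 * d)%:R * \sum_e \sum_f w e f.
  by rewrite !mulr_sumr; apply: ler_sum => e _; case: (tauE e).
suff : \sum_e \sum_f w e f * (final_colour Q.+1 e == final_colour Q.+1 f)%:R <= S + S.
  move/(ler_wpM2l (ler0n R Q.+1)); rewrite mulrDr => /le_trans; apply.
  apply: le_trans (lerD SW SW) _; rewrite -mulrDl -natrD.
  by rewrite (_ : (2 * d + 2 * d = 4 * d)%N) //; lia.
pose I e f : bool := (final_colour (tau e) f == Some (H (c e) (tau e)))
  || (final_colour (tau e) f == None) && (H (c f) (tau e) == H (c e) (tau e)).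
have SE : S = \sum_e \sum_f w e f * (I e f)%:R by [].
have SE' : S = \sum_e \sum_f w f e * (I f e)%:R by rewrite SE exchange_big.
rewrite {1}SE SE' -big_split; apply: ler_sum => e _ /=.
rewrite -big_split; apply: ler_sum => f _ /=; rewrite [w f e]w_sym -mulrDr ler_wpM2l //.
rewrite -natrD ler_nat.
have sym e1 e2 : final_colour Q.+1 e1 = final_colour Q.+1 e2 ->
    (tau e2 <= tau e1)%N -> I e1 e2.
  rewrite (tauE e1).1 => e12 le21; apply/orP.
  case: (ltngtP (tau e2) (tau e1)) le21 => // [lt _|/val_inj eq _].
    left; rewrite e12; apply/eqP.
    have [t0 t1] := tauP e2; case t1E: (final_colour (tau e2).+1 e2) t1 => [y|] // _.
    by rewrite (final_keep_le lt t1E) (final_keep_le (ltn_ord (tau e2)) t1E).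
  right; rewrite -eq (tauP e2).1 eqxx /=.
  by move: e12; rewrite (tauE e2).1 -eq => -[->].
case: eqP => // ef; case: (leqP (tau f) (tau e)) => [le|/ltnW le].
  by rewrite (sym e f).
by rewrite (sym f e) // addn1.
Qed.

End HashColouring.

(** * Derandomised rounding *)

Section Rounding.
Variables (R : realFieldType) (E : finType) (a : E -> R) (m : E -> E -> R).

(** For symmetric [m] this is the partial derivative of [potential] at [e]. *)
Definition gradient (k : R) (x : E -> R) (e : E) : R := a e - 2 * k * \sum_f m e f * x f.

Definition potential (k : R) (x : E -> R) : R :=
  \sum_e a e * x e - k * \sum_e \sum_f m e f * x e * x f.

Section Pass.
Variables (Q : nat) (k thr : R) (chi : E -> option 'I_Q.+1).

Definition round_slot (j : 'I_Q.+1) (x : E -> R) (e : E) : R :=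
  if (chi e == Some j) && (0 < x e < thr) then
    (if 0 <= gradient k x e then 2 * x e else 0)
  else x e.

Fixpoint round_pass (x : E -> R) (j : nat) : E -> R :=
  if j is i.+1 then round_slot (inord i) (round_pass x i) else x.

Lemma round_pass_untouched x j e (i : 'I_Q.+1) :
  chi e = Some i -> (j <= i)%N -> round_pass x j e = x e.
Proof.
move=> ce; elim: j => [//|j IH] ji; rewrite /= /round_slot IH ?(ltnW ji) // ce.
case: eqP => // -[/(congr1 val)] /= ij.
by move: (ji); rewrite ij inordK ?ltnn // (ltn_trans ji).
Qed.

Lemma round_pass_value x e (i : 'I_Q.+1) : chi e = Some i ->
  round_pass x Q.+1 e =
    if 0 < x e < thr then
      (if 0 <= gradient k (round_pass x i) e then 2 * x e else 0) else x e.
Proof.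
move=> ce.
have: round_pass x i.+1 e = if 0 < x e < thr then
      (if 0 <= gradient k (round_pass x i) e then 2 * x e else 0) else x e.
  by rewrite /= /round_slot inord_val ce eqxx /= (round_pass_untouched _ ce).
move=> <-; rewrite -[in LHS](subnKC (ltn_ord i)).
have : (i.+1 + (Q.+1 - i.+1) <= Q.+1)%N by rewrite subnKC.
elim: (Q.+1 - i.+1)%N => [|l IH] lQ; first by rewrite addn0.
rewrite addnS in lQ *; rewrite -IH 1?ltnW //= /round_slot ce.
case: eqP => // -[/(congr1 val)]; rewrite /= inordK //; lia.
Qed.

Hypothesis m_ge0 : forall e f, 0 <= m e f.
Hypothesis m_sym : forall e f, m e f = m f e.
Hypothesis k_ge0 : 0 <= k.

(** The potential is quadratic, so its change is a linear term in [dx] minus [k] times the quadratic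
    form at [dx]. The sign rule makes the linear term nonnegative; [dx] is at most [x] in absolute
    value and vanishes outside colour [j]. *)
Lemma potential_slot j x : (forall e, 0 <= x e) ->
  potential k x - k * (\sum_e \sum_f m e f * x e * x f *
      ((chi e == Some j) && (chi f == Some j))%:R)
    <= potential k (round_slot j x).
Proof.
move=> x0; pose dx e := round_slot j x e - x e.
have -> : potential k (round_slot j x) = potential k x
    + \sum_e dx e * gradient k x e - k * \sum_e \sum_f m e f * dx e * dx f.
  have cross : \sum_e \sum_f m e f * dx e * x f = \sum_e \sum_f m e f * x e * dx f.
    rewrite exchange_big; apply: eq_bigr => e _; apply: eq_bigr => f _.
    by rewrite m_sym; ring.
  have -> : \sum_e dx e * gradient k x e =
      \sum_e a e * dx e - k * (\sum_e \sum_f m e f * dx e * x f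
        + \sum_e \sum_f m e f * x e * dx f).
    rewrite -cross -big_split mulr_sumr -sumrB; apply: eq_bigr => e _ /=.
    rewrite /gradient (_ : \sum_f m e f * dx e * x f = dx e * \sum_f m e f * x f).
      ring.
    by rewrite mulr_sumr; apply: eq_bigr => f _; ring.
  rewrite /potential.
  have -> : \sum_e a e * round_slot j x e = \sum_e a e * x e + \sum_e a e * dx e.
    by rewrite -big_split; apply: eq_bigr => e _; rewrite /dx /=; ring.
  have -> : \sum_e \sum_f m e f * round_slot j x e * round_slot j x f =
     \sum_e \sum_f m e f * x e * x f + \sum_e \sum_f m e f * dx e * x f
     + \sum_e \sum_f m e f * x e * dx f + \sum_e \sum_f m e f * dx e * dx f.
    rewrite -!big_split; apply: eq_bigr => e _; rewrite -!big_split.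
    by apply: eq_bigr => f _; rewrite /dx /=; ring.
  ring.
have dxE e : dx e = if (chi e == Some j) && (0 < x e < thr) then
    (if 0 <= gradient k x e then x e else - x e) else 0.
  by rewrite /dx /round_slot; case: ifP => _; [case: ifP => _; ring | rewrite subrr].
have lin : 0 <= \sum_e dx e * gradient k x e.
  apply: sumr_ge0 => e _; rewrite dxE; case: ifP => _; last by rewrite mul0r.
  case: ifP => g; first exact: mulr_ge0.
  by rewrite mulNr -mulrN mulr_ge0 // oppr_ge0 ltW // ltNge g.
have quad : \sum_e \sum_f m e f * dx e * dx f <= \sum_e \sum_f m e f * x e * x f *
      ((chi e == Some j) && (chi f == Some j))%:R.
  apply: ler_sum => e _; apply: ler_sum => f _; rewrite -!mulrA ler_wpM2l //.
  apply: le_trans (ler_norm _) _; rewrite normrM !dxE.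
  do 2!case: eqP => _ /=; rewrite ?normr0 ?mul0r ?mulr0 ?mulr1 //.
  by apply: ler_pM => //; do 2?case: ifP => _; rewrite ?normr0 ?normrN ?ger0_norm.
have := ler_wpM2l k_ge0 quad; lra.
Qed.

Lemma round_pass_ge0 x j : (forall e, 0 <= x e) -> forall e, 0 <= round_pass x j e.
Proof.
move=> x0; elim: j => [|j IH] e //=; rewrite /round_slot.
by case: ifP => _ //; case: ifP => _ //; apply: mulr_ge0.
Qed.

(** An edge still has its initial value when its slot comes, so the losses add up to the
    monochromatic part of the initial cost. *)
Lemma potential_pass x : (forall e, 0 <= x e) -> (forall e, chi e != None) ->
  potential k x - k * (\sum_e \sum_f m e f * x e * x f * (chi e == chi f)%:R)
    <= potential k (round_pass x Q.+1).
Proof.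
move=> x0 chiN.
pose mono (i : nat) e f : bool := (chi e == Some (inord i)) && (chi f == Some (inord i)).
have main j : (j <= Q.+1)%N ->
    potential k x - k * \sum_(i < j) (\sum_e \sum_f m e f * x e * x f * (mono i e f)%:R)
    <= potential k (round_pass x j).
  elim: j => [|j IH] jQ; first by rewrite big_ord0 mulr0 subr0.
  rewrite big_ord_recr /= mulrDr opprD addrA.
  have := potential_slot (inord j) (round_pass_ge0 j x0).
  have -> : \sum_e \sum_f m e f * round_pass x j e * round_pass x j f *
      ((chi e == Some (inord j)) && (chi f == Some (inord j)))%:R =
      \sum_e \sum_f m e f * x e * x f * (mono j e f)%:R.
    apply: eq_bigr => e _; apply: eq_bigr => f _; rewrite /mono.
    case: eqP => [ce|_]; last by rewrite !mulr0.
    case: eqP => [cf|_]; last by rewrite !mulr0.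
    by rewrite (round_pass_untouched _ ce) ?(round_pass_untouched _ cf) // inordK.
  have := IH (ltnW jQ); lra.
apply: le_trans (main _ (leqnn _)); rewrite lerD2l lerN2 ler_wpM2l //.
rewrite exchange_big; apply: ler_sum => e _ /=.
rewrite exchange_big; apply: ler_sum => f _ /=.
rewrite -mulr_sumr ler_wpM2l ?mulr_ge0 // -natr_sum ler_nat.
case: eqP => [ef|nef]; last first.
  rewrite big1 // => i _; rewrite /mono.
  by case: eqP => //= ce; case: eqP => // cf; case: nef; rewrite ce cf.
case ce: (chi e) (chiN e) => [y|] // _.
rewrite (bigD1 y) //= big1 ?addn0 ?leq_b1 // => i iy.
by rewrite /mono inord_val ce; case: eqP => // -[yi]; rewrite yi eqxx in iy.
Qed.

End Pass.
End Rounding.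

(** * Rounding stages with a two-level defective colouring *)

Section Stages.
Variables (R : realFieldType) (E : finType) (a : E -> R) (m : E -> E -> R) (c : E -> nat).
Variables (Q1 Q2 : nat) (H1 : nat -> 'I_Q1.+1 -> 'I_Q1.+1) (H2 : nat -> 'I_Q2.+1 -> 'I_Q2.+1).
Variables (d1 d2 s : nat).

Definition pair_weight (x : E -> R) e f := m e f * x e * x f.
Definition stage_base (x : E -> R) : E -> nat := hash_colour (pair_weight x) H1 c.
(** The second hash family separates only distinct base colours; pairs with equal base colour are
    charged to the defect of the base colouring instead. *)
Definition stage_weight (x : E -> R) e f :=
  if stage_base x e == stage_base x f then 0 else pair_weight x e f.
Definition stage_class (x : E -> R) : E -> option 'I_Q2.+1 :=
  final_colour (stage_weight x) H2 (stage_base x) d2 Q2.+1.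
Definition stage (k thr : R) (x : E -> R) : E -> R :=
  round_pass a m k thr (stage_class x) x Q2.+1.

(** The cost coefficient falls from 4 to 2 in equal steps, which pays for the losses of the stages,
    while the threshold doubles up to 1. *)
Fixpoint rounding (x : E -> R) (i : nat) : E -> R :=
  if i is j.+1 then stage (4 - 2 * j.+1%:R / s%:R) (2 ^+ j.+1 / 2 ^+ s) (rounding x j) else x.

Hypothesis m_ge0 : forall e f, 0 <= m e f.
Hypothesis m_sym : forall e f, m e f = m f e.
Hypothesis agree1 : forall e f, 0 < m e f ->
  (#|[set t | H1 (c e) t == H1 (c f) t]| <= d1)%N.
Hypothesis agree2 : forall i j, (i < Q1.+1 * Q1.+1)%N -> (j < Q1.+1 * Q1.+1)%N ->
  i != j -> (#|[set t | H2 i t == H2 j t]| <= d2)%N.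
Hypothesis level2 : forall i y, (#|[set t | H2 i t == y]| <= d2)%N.
Hypothesis s_gt0 : (0 < s)%N.
Hypothesis small1 : (4 * s * d1 <= Q1.+1)%N.
Hypothesis small2 : (16 * s * d2 <= Q2.+1)%N.

Section OneStage.
Variable x : E -> R.
Hypothesis x_ge0 : forall e, 0 <= x e.

Let pw_ge0 e f : 0 <= pair_weight x e f. Proof. by rewrite !mulr_ge0. Qed.
Let sw_ge0 e f : 0 <= stage_weight x e f. Proof. by rewrite /stage_weight; case: ifP. Qed.
Let sw_sym e f : stage_weight x e f = stage_weight x f e.
Proof.
by rewrite /stage_weight eq_sym /pair_weight m_sym mulrAC.
Qed.

Let sw_agree e f : 0 < stage_weight x e f ->
  (#|[set t | H2 (stage_base x e) t == H2 (stage_base x f) t]| <= d2)%N.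
Proof.
rewrite /stage_weight; case: ifP => [|nef _]; first by rewrite ltxx.
by apply: agree2; rewrite ?hash_colour_lt // nef.
Qed.

Let sw_level e y : (#|[set t | H2 (stage_base x e) t == y]| <= d2)%N.
Proof. exact: level2. Qed.

Lemma stage_class_some e : exists y, stage_class x e = Some y.
Proof. exact: final_colour_some sw_ge0 sw_agree sw_level sw_sym e. Qed.

Lemma stage_defect :
  \sum_e \sum_f m e f * x e * x f * (stage_class x e == stage_class x f)%:R
    <= (2 * s%:R)^-1 * \sum_e \sum_f m e f * x e * x f.
Proof.
set W := \sum_e \sum_f m e f * x e * x f.
have W0 : 0 <= W by apply: sumr_ge0 => e _; apply: sumr_ge0 => f _; exact: pw_ge0.
have s0 : 0 < s%:R :> R by rewrite ltr0n.
have part1 : \sum_e \sum_f pair_weight x e f * (stage_base x e == stage_base x f)%:R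
    <= (4 * s%:R)^-1 * W.
  have: Q1.+1%:R * \sum_e \sum_f pair_weight x e f * (stage_base x e == stage_base x f)%:R
      <= d1%:R * W.
    rewrite !mulr_sumr; apply: ler_sum => e _; apply: hash_colour_defect => //.
    move=> e' f'; rewrite /pair_weight => pos; apply: agree1.
    by rewrite lt_neqAle m_ge0 andbT eq_sym; apply: contraTneq pos => ->; rewrite !mul0r ltxx.
  set S := \sum_e _ => SW.
  have S0 : 0 <= S by apply: sumr_ge0 => e _; apply: sumr_ge0 => f _; apply: mulr_ge0.
  rewrite mulrC ler_pdivlMr ?mulr_gt0 //.
  have small1' : 4 * s%:R * d1%:R <= Q1.+1%:R :> R by rewrite -!natrM ler_nat.
  (* The general case cancels [d1], so [d1 = 0] is treated apart. *)
  have [d10|d1_gt0] := posnP d1.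
    have : Q1.+1%:R * S <= 0 by apply: le_trans SW _; rewrite d10 mul0r.
    rewrite pmulr_rle0 // => S0'; apply: le_trans W0; rewrite pmulr_lle0 //.
    by rewrite mulr_gt0.
  rewrite -(ler_pM2l (_ : 0 < d1%:R :> R)) ?ltr0n //.
  apply: le_trans SW; rewrite mulrCA mulrC ler_wpM2r //.
  by apply: le_trans small1'; rewrite mulrC.
have part2 : \sum_e \sum_f stage_weight x e f * (stage_class x e == stage_class x f)%:R
    <= (4 * s%:R)^-1 * W.
  have := final_colour_defect sw_ge0 sw_agree sw_level sw_sym.
  rewrite -/(stage_class x).
  set S := \sum_e _ => SW.
  have S0 : 0 <= S by apply: sumr_ge0 => e _; apply: sumr_ge0 => f _; apply: mulr_ge0.
  have {}SW : Q2.+1%:R * S <= (4 * d2)%:R * W.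
    apply: le_trans SW _; rewrite ler_wpM2l //; apply: ler_sum => e _; apply: ler_sum => f _.
    by rewrite /stage_weight; case: ifP => // _; exact: pw_ge0.
  rewrite mulrC ler_pdivlMr ?mulr_gt0 //.
  have small2' : 4 * s%:R * (4 * d2)%:R <= Q2.+1%:R :> R.
    by rewrite -!natrM ler_nat; apply: leq_trans small2; lia.
  have [d20|d2_gt0] := posnP (4 * d2)%N.
    have : Q2.+1%:R * S <= 0 by apply: le_trans SW _; rewrite d20 mul0r.
    rewrite pmulr_rle0 // => S0'; apply: le_trans W0; rewrite pmulr_lle0 //.
    by rewrite mulr_gt0.
  rewrite -(ler_pM2l (_ : 0 < (4 * d2)%:R :> R)) ?ltr0n //.
  apply: le_trans SW; rewrite mulrCA mulrC ler_wpM2r //.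
  by apply: le_trans small2'; rewrite mulrC.
apply: le_trans (_ : (4 * s%:R)^-1 * W + (4 * s%:R)^-1 * W <= _).
  apply: le_trans (lerD part1 part2); rewrite -big_split; apply: ler_sum => e _ /=.
  rewrite -big_split; apply: ler_sum => f _ /=; rewrite -/(pair_weight x e f) /stage_weight.
  case: (stage_base x e == stage_base x f).
    by rewrite mulr1 mul0r addr0 ler_piMr // lern1 leq_b1.
  by rewrite mulr0 add0r.
have -> : (4 * s%:R)^-1 * W + (4 * s%:R)^-1 * W = (2 * s%:R)^-1 * W; last by [].
by field; rewrite gt_eqF.
Qed.

Lemma stage_value k thr e : 0 < thr ->
  [|| stage k thr x e == 0, (stage k thr x e == 2 * x e) && (x e < thr) |
      (stage k thr x e == x e) && (thr <= x e)].
Proof.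
move=> t0; have [i ci] := stage_class_some e.
rewrite /stage (round_pass_value _ _ _ _ _ ci).
case: (ltgtP 0 (x e)) => [xe|xe|<-]; [| by rewrite ltNge x_ge0 in xe | by rewrite eqxx].
by case: (ltP (x e) thr) => xt /=; [case: ifP; rewrite ?eqxx ?orbT | rewrite eqxx !orbT].
Qed.

Lemma potential_stage k thr : 0 <= k ->
  potential a m k x - k * ((2 * s%:R)^-1 * \sum_e \sum_f m e f * x e * x f)
    <= potential a m k (stage k thr x).
Proof.
move=> k0; apply: le_trans (potential_pass _ _ m_ge0 m_sym k0 x_ge0 _); last first.
  by move=> e; have [y ->] := stage_class_some e.
by rewrite lerD2l lerN2 ler_wpM2l // stage_defect.
Qed.

End OneStage.

Variable x : E -> R.
Hypothesis x_low : forall e, (2 ^+ s)^-1 <= x e.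
Hypothesis x_high : forall e, x e < 2.

(** A nonzero value below the next threshold is at least half of it, so doubling reaches it; as
    thresholds are at most 1, doubled values stay below 2. *)
Lemma rounding_range i e : (i <= s)%N ->
  ((rounding x i e == 0) || (2 ^+ i / 2 ^+ s <= rounding x i e)) && (rounding x i e < 2).
Proof.
elim: i e => [|i IH] e is_; first by rewrite /= mul1r x_low x_high orbT.
have x0 f : 0 <= rounding x i f.
  case/andP: (IH f (ltnW is_)) => /orP[/eqP -> //|le _]; apply: le_trans le.
  by rewrite divr_ge0 ?exprn_ge0.
have t0 : 0 < 2 ^+ i.+1 / 2 ^+ s :> R by rewrite divr_gt0 ?exprn_gt0.
have t1 : 2 ^+ i.+1 / 2 ^+ s <= 1 :> R.
  by rewrite ler_pdivrMr ?exprn_gt0 // mul1r ler_eXn2l // ltr1n.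
case/andP: (IH e (ltnW is_)) => low high.
rewrite [rounding _ _]/=; set k := 4 - _.
case/or3P: (stage_value x0 k e t0) => [/eqP ->|/andP[/eqP -> lt]|/andP[/eqP -> ge]].
- by rewrite eqxx ltr0n.
- rewrite mulf_eq0 pnatr_eq0 /= exprS -mulrA ler_pM2l // low /=.
  by rewrite -[ltRHS]mulr1 ltr_pM2l //; apply: lt_le_trans lt t1.
- by rewrite ge orbT.
Qed.

Lemma rounding_ge0 i e : (i <= s)%N -> 0 <= rounding x i e.
Proof.
move/(rounding_range e)/andP => [/orP[/eqP -> //|le _]]; apply: le_trans le.
by rewrite divr_ge0 ?exprn_ge0.
Qed.

(** A stage loses at most [k / (2 * s)] times the cost. With [k <= 4] this is covered by the [2 / s]
    times the cost that lowering the coefficient releases. *)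
Lemma potential_rounding i : (i <= s)%N ->
  potential a m 4 x <= potential a m (4 - 2 * i%:R / s%:R) (rounding x i).
Proof.
have s0 : 0 < s%:R :> R by rewrite ltr0n.
elim: i => [|i IH] is_; first by rewrite mulr0 mul0r subr0.
apply: le_trans (IH (ltnW is_)) _; rewrite [rounding _ i.+1]/=.
set k := 4 - 2 * i.+1%:R / s%:R; set y := rounding x i.
have y0 e : 0 <= y e by apply: rounding_ge0; exact: ltnW.
have is1 : i.+1%:R / s%:R <= 1 :> R by rewrite ler_pdivrMr // mul1r ler_nat.
have is0 : 0 <= i.+1%:R / s%:R :> R by rewrite divr_ge0.
have k4 : 0 <= k <= 4 by rewrite /k -mulrA; lra.
apply: le_trans (potential_stage y0 _ (proj1 (andP k4))).
rewrite /potential; set W := \sum_e \sum_f _.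
have W0 : 0 <= W by apply: sumr_ge0 => e _; apply: sumr_ge0 => f _; rewrite !mulr_ge0.
have -> : 4 - 2 * i%:R / s%:R = k + 2 / s%:R.
  by rewrite /k -[i.+1]addn1 natrD; field; rewrite gt_eqF.
have : k * ((2 * s%:R)^-1 * W) <= 2 / s%:R * W.
  rewrite mulrA ler_wpM2r // (_ : 2 / s%:R = 4 * (2 * s%:R)^-1).
    by rewrite ler_wpM2r ?invr_ge0 ?mulr_ge0 //; case/andP: k4.
  by field; rewrite gt_eqF.
lra.
Qed.

Lemma rounding_value e : (rounding x s e == 0) || (1 <= rounding x s e < 2).
Proof.
have := rounding_range e (leqnn s); rewrite divff ?expf_eq0 ?pnatr_eq0 ?andbF //.
by case/andP => /orP[->//|->] ->; rewrite orbT.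
Qed.

Lemma rounding_potential : \sum_e a e * x e - 4 * (\sum_e \sum_f m e f * x e * x f)
  <= \sum_e a e * rounding x s e
     - 2 * (\sum_e \sum_f m e f * rounding x s e * rounding x s f).
Proof.
have := potential_rounding (leqnn s); rewrite mulfK ?pnatr_eq0 -?lt0n //.
by rewrite (_ : 4 - 2 = 2 :> R); [rewrite /potential | ring].
Qed.

End Stages.

(** * Approximate hypergraph matching *)

Section Overlap.
Variables (V E : finType) (inc : E -> {set V}).

(** Counting common vertices with multiplicity turns sums over conflicting edges into sums over
    vertices and their edges, as messages travel in the incidence graph. *)
Definition overlap (e f : E) : nat := if e == f then 0%N else #|inc e :&: inc f|.

Lemma overlap_sym e f : overlap e f = overlap f e.
Proof. by rewrite /overlap eq_sym setIC. Qed.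

Lemma overlap_gt0 e f : (0 < overlap e f)%N = (e != f) && ~~ [disjoint inc e & inc f].
Proof. by rewrite /overlap -setI_eq0 -card_gt0; case: eqP. Qed.

Lemma sum_overlap (M : nmodType) (e : E) (F : E -> M) :
  \sum_f F f *+ overlap e f = \sum_(v in inc e) \sum_(f | (v \in inc f) && (f != e)) F f.
Proof.
rewrite (exchange_big_dep (fun f => f != e)) /=; last by move=> v f _ /andP[].
rewrite [RHS]big_mkcond /=; apply: eq_bigr => f _; rewrite /overlap eq_sym.
case: eqP => _ /=; first by rewrite mulr0n.
rewrite sumr_const; congr (_ *+ _); apply: eq_card => v.
by rewrite !inE [RHS]unfold_in /= andbT.
Qed.

End Overlap.

(** * Selection of local maxima *)

Section Selection.
Variables (R : realFieldType) (V E : finType) (inc : E -> {set V}) (a : E -> R).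
Variables (id : E -> nat).

Definition conflict_cost (e f : E) : R := Num.min (a e) (a f) *+ overlap inc e f.

Definition beats (e f : E) : bool := (a f < a e) || (a f == a e) && (id f < id e)%N.

(** The local maximum condition is written as a vanishing overlap sum, the form that the locality
    lemmas handle. *)
Definition selected (x : E -> R) : {set E} :=
  [set e | (x e != 0) &&
           (\sum_f ((x f != 0) && ~~ beats e f)%:R *+ overlap inc e f == 0 :> R)].

Hypothesis a_ge0 : forall e, 0 <= a e.

Lemma conflict_cost_ge0 e f : 0 <= conflict_cost e f.
Proof. by rewrite mulrn_wge0 // le_min !a_ge0. Qed.

Lemma conflict_cost_sym e f : conflict_cost e f = conflict_cost f e.
Proof. by rewrite /conflict_cost minC overlap_sym. Qed.

Lemma in_selected x e : (e \in selected x) = (x e != 0) &&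
  [forall f, (x f != 0) && (0 < overlap inc e f)%N ==> beats e f].
Proof.
rewrite inE psumr_eq0 => [|f _]; last by rewrite mulrn_wge0.
congr (_ && _); apply/allP/forallP => /= H f; have := H f; rewrite ?mem_index_enum.
  move=> /(_ isT); rewrite mulrn_eq0 lt0n pnatr_eq0.
  by case: (x f != 0); case: (overlap inc e f == 0)%N; case: beats.
rewrite mulrn_eq0 lt0n pnatr_eq0.
by case: (x f != 0); case: (overlap inc e f == 0)%N; case: beats.
Qed.

Lemma selectedP x e f : e \in selected x -> x f != 0 -> (0 < overlap inc e f)%N -> beats e f.
Proof. by rewrite in_selected => /andP[_ /forallP/(_ f)] + xf ov; rewrite xf ov. Qed.

Lemma selected_disjoint x e f :
  e \in selected x -> f \in selected x -> e != f -> [disjoint inc e & inc f].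
Proof.
move=> se sf ef; apply: contraT => nd.
have ov : (0 < overlap inc e f)%N by rewrite overlap_gt0 ef.
have xe : x e != 0 by move: se; rewrite in_selected => /andP[].
have xf : x f != 0 by move: sf; rewrite in_selected => /andP[].
have := selectedP se xf ov; rewrite overlap_sym in ov; have := selectedP sf xe ov.
rewrite /beats; case: (ltgtP (a e) (a f)) => //= _.
by case: (ltngtP (id e) (id f)).
Qed.

(** A nonzero unselected [e] has a nonzero conflicting [f] with [a e <= a f]. Both values are at
    least 1, so this pair alone costs at least [a e]. *)
Lemma selected_weight x : (forall e, (x e == 0) || (1 <= x e < 2)) ->
  2^-1 * \sum_e a e * x e - \sum_e \sum_f conflict_cost e f * x e * x f
    <= \sum_(e in selected x) a e.
Proof.
move=> xv.
have x0 e : 0 <= x e by case/orP: (xv e) => [/eqP ->|]; lra.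
have half : 2^-1 * \sum_e a e * x e <= \sum_(e | x e != 0) a e.
  rewrite mulr_sumr [leRHS]big_mkcond; apply: ler_sum => e _.
  case: eqP (xv e) => /= [->|_ /andP[_ x2]]; first by rewrite !mulr0.
  by rewrite mulrCA ler_piMr //; lra.
rewrite lerBlDr; apply: le_trans half _.
rewrite (bigID (mem (selected x))) /= lerD //.
  by rewrite [leRHS]big_mkcond [leLHS]big_mkcond /=; apply: ler_sum => e _;
     case: (e \in selected x); rewrite ?andbF // andbT; case: ifP.
rewrite [leLHS]big_mkcond; apply: ler_sum => e _.
have cost0 f : 0 <= conflict_cost e f * x e * x f.
  by rewrite !mulr_ge0 ?conflict_cost_ge0.
case: ifP => [/andP[xe]|_]; last exact: sumr_ge0.
rewrite in_selected xe /= negb_forall => /existsP[f]; rewrite negb_imply.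
case/andP => /andP[xf ov] bef.
rewrite (bigD1 f) //= -[leLHS]addr0 lerD ?sumr_ge0 // -mulrA.
have x1 : 1 <= x e * x f.
  have := xv e; have := xv f; rewrite (negbTE xe) (negbTE xf) /= => /andP[x1 _] /andP[x1' _].
  exact: mulr_ege1.
apply: le_trans (_ : conflict_cost e f <= _); last by rewrite ler_peMr ?conflict_cost_ge0.
have le_ef : a e <= a f by rewrite leNgt; move: bef; rewrite negb_or => /andP[].
rewrite /conflict_cost (min_idPl le_ef) -[leLHS]mulr1n ler_wpMn2l //.
Qed.

End Selection.

(** * Approximation guarantee *)

Section Approximation.
Variables (R : realFieldType) (V E : finType) (inc : E -> {set V}) (a : E -> R).
Variables (r D J : nat) (id c : E -> nat).
Variables (Q1 Q2 : nat) (H1 : nat -> 'I_Q1.+1 -> 'I_Q1.+1) (H2 : nat -> 'I_Q2.+1 -> 'I_Q2.+1).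
Variables (d1 d2 : nat).

(** Chosen so that [2 ^ stages] bounds [192 * J * (r * D.+1)], the reciprocal of the lower bound for
    the scaled values. *)
Definition stages := (2 * J + 8)%N.

(** The divisor is [8 * r] times the load bound. Truncation bounds all edges uniformly; on nonempty
    ones the load bound makes it inactive. *)
Definition scaled_fractional (e : E) : R :=
  Num.min 1 (mwu_output inc a r D J e / (8 * r * (24 * J))%:R).

Definition approx_matching : {set E} :=
  selected inc a id
    (rounding a (conflict_cost inc a) c H1 H2 d2 stages scaled_fractional stages).

Hypothesis a_ge0 : forall e, 0 <= a e.
Hypothesis a_empty : forall e, inc e = set0 -> a e = 0.
Hypothesis J_gt0 : (0 < J)%N.
Hypothesis r_gt0 : (0 < r)%N.
Hypothesis rDJ : (r * D.+1 <= 2 ^ J)%N.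
Hypothesis rank : forall e, (#|inc e| <= r)%N.
Hypothesis degree : forall v, (#|[set e | v \in inc e]| <= D)%N.
Hypothesis agree1 : forall e f, (0 < overlap inc e f)%N ->
  (#|[set t | H1 (c e) t == H1 (c f) t]| <= d1)%N.
Hypothesis agree2 : forall i j, (i < Q1.+1 * Q1.+1)%N -> (j < Q1.+1 * Q1.+1)%N ->
  i != j -> (#|[set t | H2 i t == H2 j t]| <= d2)%N.
Hypothesis level2 : forall i y, (#|[set t | H2 i t == y]| <= d2)%N.
Hypothesis small1 : (4 * stages * d1 <= Q1.+1)%N.
Hypothesis small2 : (16 * stages * d2 <= Q2.+1)%N.

Lemma approx_matching_disjoint e f :
  e \in approx_matching -> f \in approx_matching -> e != f -> [disjoint inc e & inc f].
Proof. exact: selected_disjoint. Qed.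

Let h := mwu_output inc a r D J.
Let S : nat := (8 * r * (24 * J))%N.
Let x0 := scaled_fractional.

Let S_gt0 : 0 < S%:R :> R. Proof. by rewrite ltr0n !muln_gt0 r_gt0 J_gt0. Qed.

Let h_gt0 e : 0 < h e.
Proof. by apply: lt_le_trans (mwu_output_ge inc a r D J_gt0 e); rewrite invr_gt0. Qed.

Let x0_ge0 e : 0 <= x0 e.
Proof. by rewrite le_min ler01 divr_ge0 // ltW. Qed.

Let x0_low e : (2 ^+ stages)^-1 <= x0 e.
Proof.
rewrite le_min invf_le1 ?exprn_gt0 // exprn_ege1 ?ler1n //=.
apply: le_trans (_ : D.+1%:R^-1 / S%:R <= _); last first.
  by rewrite ler_wpM2r ?invr_ge0 ?(ltW S_gt0) // mwu_output_ge.
rewrite -invfM -natrM lef_pV2 ?posrE ?exprn_gt0 ?mulr_gt0 ?ltr0n ?muln_gt0 ?r_gt0 //.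
rewrite -natrX ler_nat /S /stages.
have -> : (D.+1 * (8 * r * (24 * J)) = 192 * J * (r * D.+1))%N by lia.
apply: leq_trans (leq_mul (leqnn _) rDJ) _.
have -> : (2 * J + 8 = 8 + J + J)%N by lia.
rewrite !expnD leq_mul2r expn_eq0 /=.
by apply: leq_mul => //; apply: ltnW; apply: ltn_expl.
Qed.

Let x0_high e : x0 e < 2.
Proof. by rewrite gt_min; apply/orP; left; lra. Qed.

Let x0_value : \sum_e a e * x0 e = (\sum_e a e * h e) / S%:R.
Proof.
rewrite mulr_suml; apply: eq_bigr => e _.
have [ie|/set0Pn[v ve]] := eqVneq (inc e) set0; first by rewrite a_empty // !mul0r.
rewrite /x0 /scaled_fractional (min_idPr _) ?mulrA // ler_pdivrMr // mul1r.
apply: le_trans (_ : (24 * J)%:R <= _); last by rewrite ler_nat /S leq_pmull // muln_gt0.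
apply: le_trans (mwu_output_load a_ge0 J_gt0 r_gt0 rDJ degree v).
by rewrite (bigD1 e) //= lerDl sumr_ge0 // => f _; apply/ltW/h_gt0.
Qed.

(** The minimum is at most [a e], and each of the at most [r] vertices of [e] carries scaled load at
    most [1 / (8 * r)]. *)
Let x0_conflict : 8 * \sum_e \sum_f conflict_cost inc a e f * x0 e * x0 f
  <= \sum_e a e * x0 e.
Proof.
rewrite mulr_sumr; apply: ler_sum => e _.
apply: le_trans (_ : 8 * (a e * x0 e * \sum_f x0 f *+ overlap inc e f) <= _).
  rewrite ler_pM2l // mulr_sumr; apply: ler_sum => f _.
  rewrite /conflict_cost !mulrnAl mulrnAr ler_wMn2r //.
  by rewrite ler_wpM2r // ler_wpM2r // ge_min lexx.
rewrite mulrCA ler_piMr ?mulr_ge0 // sum_overlap.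
apply: le_trans (_ : 8 * \sum_(v in inc e) (8 * r%:R)^-1 <= _).
  rewrite ler_pM2l //; apply: ler_sum => v _.
  apply: le_trans (_ : \sum_(f | v \in inc f) h f / S%:R <= _).
    rewrite [leRHS](bigID (fun f => f != e)) /= -[leLHS]addr0 lerD ?sumr_ge0 //.
      by apply: ler_sum => f _; rewrite ge_min lexx orbT.
    by move=> f _; rewrite divr_ge0 ?(ltW (h_gt0 _)) ?(ltW S_gt0).
  rewrite -mulr_suml ler_pdivrMr // /S natrM [(8 * r)%:R]natrM mulKf.
    exact: mwu_output_load.
  by rewrite mulf_neq0 // pnatr_eq0 // -lt0n.
rewrite sumr_const -[X in 8 * X]mulr_natr invfM -mulrA mulVKf ?pnatr_eq0 //.
by rewrite mulrC ler_pdivrMr ?ltr0n // mul1r ler_nat.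
Qed.

(* 384 = 12 * 8 * 4: the fractional matching, its scaling by 1/(8r), and a factor
   2 each for the conflicts and for rounding up to values below 2. *)
Lemma approx_matching_weight (g : E -> R) : (forall e, 0 <= g e) ->
  (forall v, \sum_(e | v \in inc e) g e <= 1) ->
  (384 * r%:R)^-1 * \sum_e a e * g e <= \sum_(e in approx_matching) a e.
Proof.
move=> g0 g1.
have cge0 := conflict_cost_ge0 inc a_ge0; have csym := conflict_cost_sym inc a.
have agree1' e f : 0 < conflict_cost inc a e f ->
    (#|[set t | H1 (c e) t == H1 (c f) t]| <= d1)%N.
  move=> pos; apply: agree1; rewrite lt0n; apply: contraTneq pos => ov.
  by rewrite /conflict_cost ov mulr0n ltxx.
have stages_gt0 : (0 < stages)%N by rewrite /stages addn_gt0 orbT.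
have val := rounding_value a c H1 cge0 csym agree2 level2 x0_low x0_high.
have pot := rounding_potential a cge0 csym agree1' agree2 level2 stages_gt0 small1 small2 x0_low x0_high.
have := selected_weight inc id a_ge0 val; rewrite -/approx_matching.
have lpv := mwu_output_value a_ge0 a_empty J_gt0 r_gt0 rDJ rank degree g0 g1.
rewrite -/h in lpv.
have lpv' : (96 * r%:R)^-1 * \sum_e a e * g e <= \sum_e a e * x0 e.
  rewrite x0_value ler_pdivlMr //; apply: le_trans lpv.
  rewrite mulrAC ler_wpM2r ?sumr_ge0 // => [e _|]; first by rewrite mulr_ge0.
  rewrite /S mulrC ler_pdivrMr ?mulr_gt0 ?ltr0n // -!natrM ler_nat; lia.
have -> : (384 * r%:R)^-1 = 4^-1 * (96 * r%:R)^-1 :> R.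
  by field; rewrite pnatr_eq0 -lt0n.
have := x0_conflict; have : 0 <= \sum_e \sum_f conflict_cost inc a e f * x0 e * x0 f.
  by apply: sumr_ge0 => e _; apply: sumr_ge0 => f _; rewrite !mulr_ge0.
move: lpv' pot; rewrite -/x0 -mulrA; lra.
Qed.

End Approximation.

(** * Locality *)

Inductive view := View0 of NodeInput | View1 of view & seq view.

Fixpoint view_input (w : view) : NodeInput :=
  match w with View0 i => i | View1 w' _ => view_input w' end.

Definition gather (out : view -> bool) (rounds : nat -> nat -> nat -> nat) : LocalAlgo :=
  {| la_state := view; la_init := View0; la_step := View1; la_out := out;
     la_rounds := rounds |}.

Record instance := Instance {
  iV : finType; iE : finType; iinc : iE -> {set iV}; ia : iE -> R;
  iid : iV + iE -> nat; icol : option (iV + iE -> nat); iid_inj : injective iid }.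

Lemma leqnSSn n : (n <= n.+2)%N. Proof. exact: leqW. Qed.

Section Locality.
Variables n D r : nat.

Definition input_of (I : instance) := mk_input (@iinc I) (@ia I) n D r (@iid I) (icol I).

Fixpoint view_at (I : instance) (t : nat) (x : iV I + iE I) : view :=
  if t is t'.+1 then View1 (view_at t' x) [seq view_at t' y | y <- nbrs (@iinc I) (@iid I) x]
  else View0 (input_of x).

Lemma run_state_gather (I : instance) out rounds t x :
  run_state (@iinc I) (gather out rounds) (@input_of I) (@iid I) t x = view_at t x.
Proof.
elim: t x => [|t IH] x //=; rewrite IH; congr View1.
by apply: eq_map => y; rewrite IH.
Qed.

Lemma view_input_at (I : instance) t (x : iV I + iE I) :
  view_input (view_at t x) = input_of x.
Proof. by elim: t => [|t IH] //=. Qed.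

(** Comparing two arbitrary instances makes [F] a function of the view alone. *)
Definition localE T X (F : forall I : instance, iE I -> X) :=
  forall (I I' : instance) (e : iE I) (e' : iE I'),
    view_at T (inr e) = view_at T (inr e') -> F I e = F I' e'.

Definition localV T X (F : forall I : instance, iV I -> X) :=
  forall (I I' : instance) (v : iV I) (v' : iV I'),
    view_at T (inl v) = view_at T (inl v') -> F I v = F I' v'.

Lemma view_at_le (I I' : instance) s t (x : iV I + iE I) (x' : iV I' + iE I') :
  (s <= t)%N -> view_at t x = view_at t x' -> view_at s x = view_at s x'.
Proof. by move/subnKC <-; elim: (t - s)%N => [|k IH]; rewrite ?addn0 // addnS => -[/IH]. Qed.

Lemma localE_le S T X (F : forall I, iE I -> X) : (S <= T)%N -> localE S F -> localE T F.
Proof. by move=> ST lF I I' e e' /(view_at_le ST)/lF. Qed.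

Lemma localE_input X (F : NodeInput -> X) :
  localE 0 (fun I e => F (input_of (inr e : iV I + iE I))).
Proof. by move=> I I' e e' /(congr1 view_input); rewrite !view_input_at => ->. Qed.

Lemma localE_weight T : localE T ia.
Proof. exact: localE_le (leq0n T) (localE_input ni_weight). Qed.

Lemma localE_id T : localE T (fun I e => iid (inr e : iV I + iE I)).
Proof. exact: localE_le (leq0n T) (localE_input ni_id). Qed.

Lemma localE_pair T X Y (F : forall I, iE I -> X) (G : forall I, iE I -> Y) :
  localE T F -> localE T G -> localE T (fun I e => (F I e, G I e)).
Proof. by move=> lF lG I I' e e' H; rewrite (lF _ _ _ _ H) (lG _ _ _ _ H). Qed.

Lemma localE_map T X Y (g : X -> Y) (F : forall I, iE I -> X) :
  localE T F -> localE T (fun I e => g (F I e)).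
Proof. by move=> lF I I' e e' H; rewrite (lF _ _ _ _ H). Qed.

Lemma eq_map_views (A A' B X : Type) (v : A -> B) (v' : A' -> B) (G : A -> X) (G' : A' -> X)
    (P : pred A) (P' : pred A') s s' :
  (forall y y', P y -> P' y' -> v y = v' y' -> G y = G' y') ->
  all P s -> all P' s' -> map v s = map v' s' -> map G s = map G' s'.
Proof.
move=> GG; elim: s s' => [|y s IH] [|y' s'] //= /andP[Py Ps] /andP[Py' Ps'] [vy vs].
by rewrite (GG y y') // (IH s').
Qed.

Lemma nbrs_adj (I : instance) (x : iV I + iE I) :
  all (fun y => inc_adj (@iinc I) x y) (nbrs (@iinc I) (@iid I) x).
Proof. by apply/allP => y; rewrite mem_sort mem_enum inE. Qed.

Lemma big_nbrs (M : nmodType) (I : instance) (x : iV I + iE I) (G : iV I + iE I -> M) :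
  \sum_(y <- nbrs (@iinc I) (@iid I) x) G y = \sum_(y | inc_adj (@iinc I) x y) G y.
Proof. by rewrite (perm_big _ (permEl (perm_sort _ _))) big_enum. Qed.

Lemma localV_sum T (M : nmodType) (F : forall I, iE I -> M) :
  localE T F -> localV T.+1 (fun I v => \sum_(e | v \in @iinc I e) F I e).
Proof.
move=> lF I I' v v' /= [_ vs].
pose G (J : instance) (y : iV J + iE J) : M := if y is inr e then F J e else 0.
have GE (J : instance) (w : iV J) : \sum_(e | w \in @iinc J e) F J e =
    \sum_(g <- [seq G J y | y <- nbrs (@iinc J) (@iid J) (inl w)]) g.
  by rewrite big_map big_nbrs big_sumType /= [X in _ = X + _]big_pred0 // add0r.
rewrite !GE; congr (\sum_(g <- _) g).
apply: eq_map_views (nbrs_adj _) (nbrs_adj _) vs => -[//|e] [//|e'] _ _ /=.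
exact: lF.
Qed.

Lemma localE_sum T (M : nmodType) (F : forall I, iV I -> M) :
  localV T F -> localE T.+1 (fun I e => \sum_(v in @iinc I e) F I v).
Proof.
move=> lF I I' v v' /= [_ vs].
pose G (J : instance) (y : iV J + iE J) : M := if y is inl v then F J v else 0.
have GE (J : instance) (e : iE J) : \sum_(v in @iinc J e) F J v =
    \sum_(g <- [seq G J y | y <- nbrs (@iinc J) (@iid J) (inr e)]) g.
  by rewrite big_map big_nbrs big_sumType /= [X in _ = _ + X]big_pred0 // addr0.
rewrite !GE; congr (\sum_(g <- _) g).
apply: eq_map_views (nbrs_adj _) (nbrs_adj _) vs => -[e|//] [e'|//] _ _ /=.
exact: lF.
Qed.

(** One round sums at the vertices and one at the edge. The edge itself is excluded by its
    identifier; its data enter as constants [i] and [x], so the inner terms depend on [f] alone. *)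
Lemma localE_overlap T (M : nmodType) X (F : forall I, iE I -> X) (psi : X -> X -> M) :
  localE T F ->
  localE T.+2 (fun I e => \sum_f psi (F I e) (F I f) *+ overlap (@iinc I) e f).
Proof.
move=> lF I I' e e' H.
have side i x : localE T.+2 (fun J e => \sum_(v in @iinc J e) \sum_(f | v \in @iinc J f)
    (if iid (inr f : iV J + iE J) == i then 0 else psi x (F J f))).
  apply: localE_sum; apply: localV_sum => J J' f f' Hf.
  by rewrite (lF _ _ _ _ Hf) (localE_id Hf).
have conv J (g : iE J) : \sum_f psi (F J g) (F J f) *+ overlap (@iinc J) g f =
    \sum_(v in @iinc J g) \sum_(f | v \in @iinc J f)
    (if iid (inr f : iV J + iE J) == iid (inr g : iV J + iE J) then 0
     else psi (F J g) (F J f)).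
  rewrite sum_overlap; apply: eq_bigr => v _; rewrite big_mkcondr; apply: eq_bigr => f _.
  rewrite (inj_eq (@iid_inj J)) (inj_eq (@inr_inj _ _)) if_neg //.
have ids := localE_id H; have Fe : F I e = F I' e' by apply: lF; exact: view_at_le (leqnSSn _) H.
by rewrite !conv ids Fe; exact: side.
Qed.

(** This shape makes sums computable in two more rounds and survives multiplication by functions of
    local data. *)
Definition localW T (w : forall I, iE I -> iE I -> R) :=
  exists X (G : forall I, iE I -> X) (psi : X -> X -> R), localE T G /\
    forall I e f, w I e f = psi (G I e) (G I f) *+ overlap (@iinc I) e f.

Lemma localW_le S T w : (S <= T)%N -> localW S w -> localW T w.
Proof. by move=> ST [X [G [psi [lG wE]]]]; exists X, G, psi; split=> //; exact: localE_le lG. Qed.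

Lemma localW_mul T w X (F : forall I, iE I -> X) (phi : X -> X -> R) :
  localW T w -> localE T F ->
  localW T (fun I e f => w I e f * phi (F I e) (F I f)).
Proof.
move=> [Y [G [psi [lG wE]]]] lF.
exists (Y * X)%type, (fun I e => (G I e, F I e)), (fun p q => psi p.1 q.1 * phi p.2 q.2).
by split; [exact: localE_pair | move=> I e f; rewrite wE mulrnAl].
Qed.

Lemma localW_sum T w : localW T w -> localE T.+2 (fun I e => \sum_f w I e f).
Proof.
move=> [Y [G [psi [lG wE]]]] I I' e e' H.
rewrite (eq_bigr _ (fun f _ => wE I e f)) (eq_bigr _ (fun f _ => wE I' e' f)).
exact: (localE_overlap psi lG H).
Qed.

Lemma localW_ext T (w w' : forall I, iE I -> iE I -> R) :
  (forall I e f, w I e f = w' I e f) -> localW T w -> localW T w'.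
Proof.
by move=> ww [Y [G [psi [lG wE]]]]; exists Y, G, psi; split=> // I e f; rewrite -ww.
Qed.

Lemma localW_sum_mul T w X (F : forall I, iE I -> X) (phi : X -> X -> R) :
  localW T w -> localE T F ->
  localE T.+2 (fun I e => \sum_f w I e f * phi (F I e) (F I f)).
Proof. by move=> lw lF; apply: localW_sum; exact: localW_mul. Qed.

Section HashLocality.
Variables (Q d : nat) (H : nat -> 'I_Q.+1 -> 'I_Q.+1).
Variables (T : nat) (w : forall I, iE I -> iE I -> R) (c : forall I, iE I -> nat).
Arguments w : clear implicits.
Arguments c : clear implicits.
Hypothesis lw : localW T w.
Hypothesis lc : localE T c.

Lemma localE_hash_colour : localE T.+2 (fun I e => hash_colour (w I) H (c I) e).
Proof.
move=> I I' e e' eq_view.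
have ce : c I e = c I' e' by apply: lc; exact: view_at_le (leqnSSn _) eq_view.
have conflict : hash_conflict (w I) H (c I) e = hash_conflict (w I') H (c I') e'.
  (* Equality in all slots at once makes the minimising slots agree. *)
  apply/funext => t.
  exact: (localW_sum_mul (fun i j => (H i t == H j t)%:R) lw lc) eq_view.
by rewrite /hash_colour /hash_slot conflict ce.
Qed.

Lemma localE_final_colour j :
  localE (T + 2 * j) (fun I e => final_colour (w I) H (c I) d j e).
Proof.
elim: j => [|j IH] //; rewrite mulnS addnCA add2n => I I' e e' eq_view /=.
have le_T : (T <= T + 2 * j)%N by rewrite leq_addr.
have lc' := localE_le le_T lc; have lw' := localW_le le_T lw.
rewrite /final_step.
have -> : final_colour (w I) H (c I) d j e = final_colour (w I') H (c I') d j e'.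
  by apply: IH; exact: view_at_le (leqnSSn _) eq_view.
have -> : c I e = c I' e' by apply: lc'; exact: view_at_le (leqnSSn _) eq_view.
have -> : \sum_f w I e f = \sum_f w I' e' f by exact: (localW_sum lw').
have -> // : final_conflict (w I) H (c I) (final_colour (w I) H (c I) d j) e (inord j) =
  final_conflict (w I') H (c I') (final_colour (w I') H (c I') d j) e' (inord j).
exact: (localW_sum_mul (fun p q => ((q.1 == Some (H p.2 (inord j))) ||
  (q.1 == None) && (H q.2 (inord j) == H p.2 (inord j)))%:R) lw' (localE_pair IH lc')).
Qed.

End HashLocality.

Section RoundingLocality.
Variables (a : forall I, iE I -> R) (m : forall I, iE I -> iE I -> R).
Variables (c : forall I, iE I -> nat) (T0 : nat).
Arguments a : clear implicits.
Arguments m : clear implicits.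
Arguments c : clear implicits.
Hypothesis la : localE T0 a.
Hypothesis lm : localW T0 m.
Hypothesis lc : localE T0 c.

Lemma localE_round_pass Q k thr (chi : forall I, iE I -> option 'I_Q.+1)
    (x : forall I, iE I -> R) T j : (T0 <= T)%N ->
  localE T chi -> localE T x ->
  localE (T + 2 * j) (fun I e => round_pass (a I) (m I) k thr (chi I) (x I) j e).
Proof.
move=> T0T lchi lx; elim: j => [|j IH] //=; first by rewrite addn0.
rewrite mulnS addnCA add2n => I I' e e' eq_view /=; rewrite /round_slot /gradient.
have le_T : (T <= T + 2 * j)%N by rewrite leq_addr.
have -> : chi I e = chi I' e'.
  by apply: lchi; apply: view_at_le eq_view; exact: leq_trans le_T (leqnSSn _).
have -> : a I e = a I' e'.
  by apply: la; apply: view_at_le eq_view; exact: leq_trans T0T (leq_trans le_T (leqnSSn _)).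
have -> : round_pass (a I) (m I) k thr (chi I) (x I) j e =
    round_pass (a I') (m I') k thr (chi I') (x I') j e'.
  by apply: IH; exact: view_at_le (leqnSSn _) eq_view.
have -> // : \sum_f m I e f * round_pass (a I) (m I) k thr (chi I) (x I) j f =
  \sum_f m I' e' f * round_pass (a I') (m I') k thr (chi I') (x I') j f.
apply: (localW_sum_mul (fun p q => q) _ IH) eq_view.
by apply: localW_le lm; rewrite (leq_trans T0T).
Qed.

Variables (Q1 Q2 : nat) (H1 : nat -> 'I_Q1.+1 -> 'I_Q1.+1) (H2 : nat -> 'I_Q2.+1 -> 'I_Q2.+1).
Variables (d2 s : nat).

(** Two rounds for the base colour, then per slot two for the final colour and two for the rounding
    pass. *)
Definition stage_time := (2 + 4 * Q2.+1)%N.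

Lemma localE_stage k thr (x : forall I, iE I -> R) T : (T0 <= T)%N -> localE T x ->
  localE (T + stage_time) (fun I e => stage (a I) (m I) (c I) H1 H2 d2 k thr (x I) e).
Proof.
move=> T0T lx.
have lmT := localW_le T0T lm; have lcT := localE_le T0T lc.
have lp : localW T (fun I e f => pair_weight (m I) (x I) e f).
  apply: localW_ext (localW_mul (fun u v => u * v) lmT lx) => I e f.
  by rewrite /pair_weight mulrA.
have lb : localE T.+2 (fun I e => stage_base (m I) (c I) H1 (x I) e).
  exact: localE_hash_colour lp lcT.
have TT : (T <= T.+2)%N by rewrite ltnW.
have lw : localW T.+2 (fun I e f => stage_weight (m I) (c I) H1 (x I) e f).
  apply: localW_ext (localW_mul (fun u v => (u != v)%:R) (localW_le TT lp) lb) => I e f.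
  by rewrite /stage_weight; case: eqP => _; rewrite ?mulr0 ?mulr1.
have lchi := localE_final_colour (j := Q2.+1) d2 H2 lw lb.
have le1 : (T <= T.+2 + 2 * Q2.+1)%N by rewrite (leq_trans TT) // leq_addr.
have := localE_round_pass k thr (j := Q2.+1) (leq_trans T0T le1) lchi (localE_le le1 lx).
rewrite -addnA -mulnDl /stage_time (_ : (2 + 2) = 4)%N //.
by rewrite -[T.+2]addn2 -addnA.
Qed.

Lemma localE_rounding (x : forall I, iE I -> R) T i : (T0 <= T)%N -> localE T x ->
  localE (T + i * stage_time) (fun I e => rounding (a I) (m I) (c I) H1 H2 d2 s (x I) i e).
Proof.
move=> T0T lx; elim: i => [|i IH]; first by rewrite addn0.
rewrite mulSn addnCA addnC /=; apply: localE_stage => //.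
by rewrite (leq_trans T0T) // leq_addr.
Qed.

End RoundingLocality.

Section MwuLocality.
Variables (a : forall I, iE I -> R) (K Dl bt gm : R) (T : nat).
Arguments a : clear implicits.
Hypothesis la : localE T a.

(** One round computes the initial lengths. In each step edges read lengths to test activity, then
    vertices read the active values. *)
Lemma local_mwu t :
  localE (T.+1 + 2 * t) (fun I e => (mwu (@iinc I) (a I) K Dl bt gm t).1 e) /\
  localV (T.+1 + 2 * t) (fun I v => (mwu (@iinc I) (a I) K Dl bt gm t).2 v).
Proof.
elim: t => [|t [lh lz]].
  split=> //=; rewrite addn0 => I I' v v' eq_view.
  by rewrite (localV_sum la eq_view).
rewrite mulnS addnCA add2n; set S := (T.+1 + 2 * t)%N in lh lz *.
have lup : localE S.+1 (fun I e =>
    if mwu_active (@iinc I) (a I) (mwu (@iinc I) (a I) K Dl bt gm t).2 e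
    then (mwu (@iinc I) (a I) K Dl bt gm t).1 e else 0).
  move=> I I' e e' eq_view; rewrite /mwu_active (localE_sum lz eq_view).
  rewrite (lh _ _ _ _ (view_at_le (leqnSn _) eq_view)).
  have TS : (T <= S.+1)%N by rewrite leqW // /S addSn leqW // leq_addr.
  by rewrite (la (view_at_le TS eq_view)).
split=> I I' y y' eq_view; rewrite !mwuS /mwu_step /=.
  rewrite (lup _ _ _ _ (view_at_le (leqnSn _) eq_view)).
  by rewrite (lh _ _ _ _ (view_at_le (leqnSSn _) eq_view)).
rewrite (localV_sum lup eq_view).
by rewrite (lz _ _ _ _ (view_at_le (leqnSSn _) eq_view)).
Qed.

End MwuLocality.

Lemma localE_selected (a x : forall I, iE I -> R) T :
  localE T a -> localE T x ->
  localE T.+2 (fun I e => e \in selected (@iinc I) (a I) (fun e => iid (inr e : iV I + iE I)) (x I)).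
Proof.
move=> la lx I I' e e' eq_view; rewrite !inE.
rewrite (lx _ _ _ _ (view_at_le (leqnSSn _) eq_view)); congr (_ && _).
pose phi (p q : R * R * nat) : R :=
  ((q.1.2 != 0) && ~~ ((q.1.1 < p.1.1) || (q.1.1 == p.1.1) && (q.2 < p.2)%N))%:R.
have := localE_overlap phi (localE_pair (localE_pair la lx) (localE_id (T := T))) eq_view.
by rewrite /phi /= => ->.
Qed.

End Locality.

(** * Reduction of the number of colours *)

Lemma ltn_exp_lg x : (x < 2 ^ lg x)%N.
Proof. exact: trunc_log_ltn. Qed.

Lemma lg_le x y : (x < 2 ^ y)%N -> (0 < y)%N -> (lg x <= y)%N.
Proof.
move=> xy y0; rewrite /lg; case: (posnP x) => [->|x0]; first by rewrite trunc_log0.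
by rewrite -(ltn_exp2l _ _ (ltnSn 1)) (leq_ltn_trans _ xy) // trunc_logP.
Qed.

Lemma leq_lg x y : (x <= y)%N -> (lg x <= lg y)%N.
Proof. by move=> xy; rewrite /lg ltnS leq_trunc_log. Qed.

Lemma exp_lg_le x : (0 < x)%N -> (2 ^ lg x <= 2 * x)%N.
Proof. by move=> x0; rewrite /lg expnS leq_mul2l trunc_logP. Qed.

Lemma logstarP x : (iter (logstar x) (trunc_log 2) x <= 1)%N.
Proof.
suff aux f y : (y <= f)%N -> (iter (logstar_aux f y) (trunc_log 2) y <= 1)%N by exact: aux.
elim: f y => [|f IH] y yf /=.
  by move: yf; rewrite leqn0 => /eqP ->.
case: (leqP y 1) => // y1; rewrite iterSr; apply: IH.
rewrite -ltnS (leq_trans _ yf) //; apply: leq_trans (ltn_expl _ (ltnSn 1)) _.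
by rewrite trunc_logP // ltnW.
Qed.

Definition proper_colouring (V E : finType) (inc : E -> {set V}) (c : E -> nat) :=
  forall e f, (0 < overlap inc e f)%N -> c e != c f.

Lemma sum_overlap_le (V E : finType) (inc : E -> {set V}) (r D : nat) e :
  rank_le inc r -> maxdeg_le inc D -> (\sum_f overlap inc e f <= r * D)%N.
Proof.
move=> rank degree.
have -> : (\sum_f overlap inc e f = \sum_(v in inc e) \sum_(f | (v \in inc f) && (f != e)) 1)%N.
  have := sum_overlap inc e (fun _ => 1%N).
  by rewrite /= => <-; apply: eq_bigr => f _; rewrite -mulr_natl mulr1 natn.
apply: leq_trans (_ : \sum_(v in inc e) D <= _)%N.
  apply: leq_sum => v _; rewrite sum1_card; apply: leq_trans (degree v).
  by apply/subset_leq_card/subsetP => f; rewrite !inE => /andP[].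
by rewrite sum_nat_const leq_mul2r rank orbT.
Qed.

Section Colours.
Variables n D r : nat.

Definition logsize := (lg r + lg D)%N.

Lemma logsize_gt1 : (1 < logsize)%N. Proof. by rewrite /logsize /lg addSn addnS. Qed.

Lemma logsizeP : (r * D.+1 <= 2 ^ logsize)%N.
Proof. by rewrite /logsize expnD leq_mul ?ltn_exp_lg // ltnW ?ltn_exp_lg. Qed.

(* With unit weights and 2^m larger than d times the degree of the line graph,
   the least conflicting slot has no conflict at all: this is one step of
   Linial's colour reduction. *)
Lemma colour_reduction (P : instance -> Prop) T b :
  (forall I, P I -> rank_le (@iinc I) r /\ maxdeg_le (@iinc I) D) -> (0 < b)%N ->
  (exists c : forall I, iE I -> nat, localE n D r T c /\
     forall I, P I -> proper_colouring (@iinc I) (c I) /\ forall e, (c I e < 2 ^ b)%N) ->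
  exists c : forall I, iE I -> nat, localE n D r T.+2 c /\
     forall I, P I -> proper_colouring (@iinc I) (c I) /\
       forall e, (c I e < 2 ^ (2 * (lg b + logsize)))%N.
Proof.
move=> Prd b0 [c [lc cP]].
have m0 : (0 < lg b + logsize)%N by rewrite addn_gt0.
have [H [agree level]] := hash_family m0 b0.
pose w I (e f : iE I) : R := 1 *+ overlap (@iinc I) e f.
exists (fun I e => hash_colour (w I) H (c I) e); split.
  apply: localE_hash_colour lc.
  by exists unit, (fun I e => tt), (fun _ _ => 1); split.
move=> I PI; have [rank degree] := Prd I PI; have [proper cb] := cP I PI.
have QE : (2 ^ (lg b + logsize)).-1.+1 = (2 ^ (lg b + logsize))%N.
  by rewrite prednK // expn_gt0.
split; last first.
  move=> e; have := hash_colour_lt (w I) H (c I) e.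
  by rewrite QE -expnD addnn -mul2n.
move=> e f ov; apply/eqP => ef.
have w0 e' f' : 0 <= w I e' f' by rewrite mulrn_wge0.
have w_agree e' f' : 0 < w I e' f' ->
    (#|[set t | H (c I e') t == H (c I f') t]| <= b)%N.
  move=> w_pos; apply: agree; try by rewrite (leq_trans (cb _)) // leq_exp2l // leq_pmull.
  by apply: proper; rewrite lt0n; apply: contraTneq w_pos => ov0; rewrite /w ov0 ltxx.
have := hash_colour_defect w0 w_agree e; apply/negP; rewrite -ltNge.
apply: lt_le_trans (_ : (2 ^ (lg b + logsize))%:R <= _).
  have -> : \sum_f0 w I e f0 = (\sum_f0 overlap (@iinc I) e f0)%:R by rewrite natr_sum.
  rewrite -natrM ltr_nat expnD.
  apply: leq_ltn_trans (leq_mul (leqnn _) (sum_overlap_le e rank degree)) _.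
  apply: leq_ltn_trans (_ : b * 2 ^ logsize < _)%N.
    rewrite leq_mul2l; apply/orP; right; apply: leq_trans logsizeP.
    by rewrite leq_mul2l leqnSn orbT.
  by rewrite ltn_pmul2r ?expn_gt0 // ltn_exp_lg.
rewrite QE ler_peMr // (bigD1 f) //= ef eqxx mulr1 -[leLHS]addr0 lerD //.
  by rewrite /w ler1n.
by apply: sumr_ge0 => f' _; rewrite mulr_ge0.
Qed.

Variable kappa : nat.

Definition colour_bits := (2 ^ (kappa + 4) * logsize)%N.

(** One reduction of colours with [colour_bits * l.+1] bits replaces [l] by its logarithm in the
    bound. The factor [2 ^ (kappa + 4)] absorbs its own logarithm. *)
Lemma colour_bits_step l :
  (2 * (lg (colour_bits * l.+1) + logsize) <= colour_bits * (trunc_log 2 l).+1)%N.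
Proof.
have J2 := logsize_gt1; rewrite /colour_bits; set J := logsize in J2 *; set t := trunc_log 2 l.
have C16 : (16 * kappa + 16 <= 2 ^ (kappa + 4))%N.
  by have := ltn_expl kappa (ltnSn 1); rewrite expnD (_ : 2 ^ 4 = 16)%N //; lia.
have lgC : (lg (2 ^ (kappa + 4) * J * l.+1) <= kappa + 5 + J + t)%N.
  apply: lg_le; last by lia.
  have -> : (kappa + 5 + J + t = (kappa + 4) + J + t.+1)%N by lia.
  rewrite [(2 ^ (_ + t.+1))%N]expnD [(2 ^ (_ + J))%N]expnD.
  have : (0 < 2 ^ (kappa + 4))%N by rewrite expn_gt0.
  move: (2 ^ (kappa + 4))%N => C C0; apply: leq_trans (_ : C * 2 ^ J * l.+1 <= _)%N.
    by rewrite (ltn_pmul2r (ltn0Sn l)) (ltn_pmul2l C0) ltn_expl.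
  by rewrite leq_mul2l; apply/orP; right; apply: trunc_log_ltn.
move: C16 lgC; set C := (2 ^ (kappa + 4))%N; set L := lg _ => C16 lgC; nia.
Qed.

(** Identifiers are the initial colours. After [logstar n] reductions the iterated logarithm of [n]
    is at most 1, and only [colour_bits] remains. *)
Lemma colour_from_ids (P : instance -> Prop) :
  (forall I, P I -> [/\ rank_le (@iinc I) r, maxdeg_le (@iinc I) D &
    forall x : iV I + iE I, (iid x < (n.+1 * D.+1) ^ kappa)%N]) ->
  exists c : forall I, iE I -> nat, localE n D r (2 * logstar n) c /\
     forall I, P I -> proper_colouring (@iinc I) (c I) /\
       forall e, (c I e < 2 ^ colour_bits)%N.
Proof.
move=> HP.
have bits_gt0 : (0 < colour_bits)%N.
  by rewrite muln_gt0 expn_gt0 /= ltnW // logsize_gt1.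
have iterate i : exists c : forall I, iE I -> nat, localE n D r (2 * i) c /\
     forall I, P I -> proper_colouring (@iinc I) (c I) /\
       forall e, (c I e < 2 ^ (colour_bits * (trunc_log 2 (iter i (trunc_log 2) n)).+1))%N.
  elim: i => [|i IH].
    exists (fun I e => iid (inr e : iV I + iE I)); split; first exact: localE_id.
    move=> I /HP[_ _ idb]; split=> [e f ov|e].
      rewrite (inj_eq (@iid_inj I)) (inj_eq (@inr_inj _ _)).
      by apply: contraTneq ov => ->; rewrite /overlap eqxx.
    apply: leq_trans (idb _) _.
    apply: leq_trans (_ : (2 ^ (lg n + lg D)) ^ kappa <= _)%N.
      case: (kappa) => [|k]; first by rewrite !expn0.
      by rewrite leq_exp2r // expnD leq_mul // ltn_exp_lg.
    rewrite -expnM leq_exp2l //= -/(lg n) /colour_bits /logsize.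
    apply: leq_trans (_ : 2 ^ kappa * ((lg r + lg D) * lg n * 16) <= _)%N.
      rewrite mulnC leq_mul //; first by rewrite ltnW // ltn_expl.
      have : (0 < lg r)%N by []. have : (0 < lg n)%N by []. have: (0 < lg D)%N by [].
      nia.
    by rewrite expnD; lia.
  have Prd I : P I -> rank_le (@iinc I) r /\ maxdeg_le (@iinc I) D by case/HP.
  have [|c [lc cP]] := colour_reduction Prd _ IH; first by rewrite muln_gt0 bits_gt0.
  exists c; split.
    by rewrite mulnS addnC addn2.
  move=> I PI; have [proper cb] := cP I PI; split=> // e.
  apply: leq_trans (cb e) _; rewrite leq_exp2l //.
  by apply: leq_trans (colour_bits_step _) _; rewrite iterS.
have [c [lc cP]] := iterate (logstar n); exists c; split=> // I PI.
have [proper cb] := cP I PI; split=> // e; apply: leq_trans (cb e) _.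
have := logstarP n; case: (iter _ _ _) => [|[|//]] _; rewrite ?trunc_log0 ?trunc_log1 muln1 //.
Qed.

End Colours.

(** * The algorithm *)

(* A view determines the output bit: accept it if some instance produces this
   view at an edge of its matching. *)
Lemma algorithm_of_local (T : nat -> nat -> nat -> nat)
    (M : nat -> nat -> nat -> forall I : instance, {set iE I}) :
  (forall n D r, localE n D r (T n D r) (fun I e => e \in M n D r I)) ->
  exists A : LocalAlgo, (forall n D r, la_rounds A n D r = T n D r) /\
    forall n D r I, run_output (@iinc I) A (@input_of n D r I) (@iid I) (T n D r) = M n D r I.
Proof.
move=> lM.
pose out w := let i := view_input w in let n := ni_n i in let D := ni_Delta i in
  let r := ni_r i in
  `[< exists (I : instance) (e : iE I), view_at n D r (T n D r) (inr e) = w /\ e \in M n D r I >].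
exists (gather out T); split=> // n D r I; apply/setP => e; rewrite inE.
rewrite run_state_gather /out /= view_input_at /=.
apply/asboolP/idP => [[I' [e' [eq_view e'M]]]|eM]; last by exists I, e.
by rewrite -(lM _ _ _ _ _ _ _ eq_view).
Qed.

Section Matching.
Variables kappa n D r : nat.
Let J := logsize D r.
Let s := stages J.
Let C := (2 ^ (kappa + 4))%N.
Let m2 := lg (64 * C * s).
Let Q2 := (2 ^ m2).-1.

Definition matching_time := ((2 + 2 * mwu_time J) + s * stage_time Q2 + 2)%N.

Let C_gt0 : (0 < C)%N. Proof. by rewrite expn_gt0. Qed.
Let s_gt0 : (0 < s)%N. Proof. by rewrite /s /stages addn_gt0 orbT. Qed.
Let J_gt0 : (0 < J)%N. Proof. exact: ltnW (logsize_gt1 D r). Qed.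

Let Q2E : Q2.+1 = (2 ^ m2)%N. Proof. by rewrite prednK ?expn_gt0. Qed.

Let Q2_low : (64 * C * s < Q2.+1)%N. Proof. by rewrite Q2E ltn_exp_lg. Qed.

(** Empty edges conflict with nothing, so they lose their weight here and join the matching at the
    end. Emptiness is tested by a sum to be visibly local. *)
Definition nonempty_weight (I : instance) (e : iE I) : R :=
  if \sum_(v in @iinc I e) 1%N == 0%N then 0 else ia e.

Lemma local_matching (P : instance -> Prop) T0 :
  (0 < r)%N ->
  (forall I, P I -> [/\ rank_le (@iinc I) r, maxdeg_le (@iinc I) D & forall e, 0 <= @ia I e]) ->
  (exists c : forall I, iE I -> nat, localE n D r T0 c /\
     forall I, P I -> proper_colouring (@iinc I) (c I) /\
       forall e, (c I e < 2 ^ colour_bits D r kappa)%N) ->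
  exists M : forall I, {set iE I},
    localE n D r (T0 + matching_time) (fun I e => e \in M I) /\
    forall I, P I -> good_output (384^-1 : R) (@iinc I) (@ia I) r (M I).
Proof.
move=> r_gt0 HP [c [lc cP]].
have m2_gt0 : (0 < m2)%N by [].
have m1_gt0 : (0 < 2 * m2)%N by rewrite muln_gt0.
have d1_gt0 : (0 < C * s)%N by rewrite muln_gt0 C_gt0.
(* Degree [C * s] over the field of size [2 ^ (2 * m2)] covers all input colours because [J <= s].
   The at most [2 ^ (4 * m2)] base colours are the domain of degree 4 over the field of size
   [2 ^ m2]. *)
have [H1 [agree1 _]] := hash_family m1_gt0 d1_gt0.
have [H2 [agree2 level2]] := hash_family m2_gt0 (isT : (0 < 4)%N).
pose M0 I := approx_matching (@iinc I) (@nonempty_weight I) r D J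
  (fun e => iid (inr e : iV I + iE I)) (c I) H1 H2 4.
pose empty I := [set e : iE I | \sum_(v in @iinc I e) 1%N == 0%N].
have emptyE I e : (e \in empty I) = (@iinc I e == set0) by rewrite inE sum1_card cards_eq0.
exists (fun I => M0 I :|: empty I); split.
  have lempty T : (0 < T)%N -> localE n D r T (fun I e => \sum_(v in @iinc I e) 1%N).
    move=> T_gt0; apply: localE_le T_gt0 _.
    by apply: (@localE_sum n D r 0 nat (fun I v => 1%N)).
  have la T : (0 < T)%N -> localE n D r T nonempty_weight.
    move=> T_gt0 I I' e e' eq_view; rewrite /nonempty_weight (lempty T T_gt0 _ _ _ _ eq_view).
    by rewrite (localE_weight eq_view).
  set T1 := (T0 + (2 + 2 * mwu_time J))%N.
  have T1_gt0 : (0 < T1)%N by rewrite /T1 addnCA addn_gt0.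
  have lx : localE n D r T1 (fun I e => scaled_fractional (@iinc I) (@nonempty_weight I) r D J e).
    have lh : localE n D r T1 (fun I e => mwu_output (@iinc I) (@nonempty_weight I) r D J e).
      apply: localE_le (local_mwu _ _ _ _ (la 1%N isT) (mwu_time J)).1.
      by rewrite /T1 leq_addl.
    exact: (localE_map (fun y => Num.min 1 (y / (8 * r * (24 * J))%:R)) lh).
  have lm : localW n D r T1 (fun I => conflict_cost (@iinc I) (@nonempty_weight I)).
    by exists R, nonempty_weight, Num.min; split; [exact: la|].
  have lcT : localE n D r T1 c by apply: localE_le lc; rewrite leq_addr.
  have lround := localE_rounding (i := s) (la T1 T1_gt0) lm lcT H1 H2 4 s (leqnn T1) lx.
  have T2_gt0 : (0 < T1 + s * stage_time Q2)%N by rewrite addn_gt0 T1_gt0.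
  have lsel := localE_selected (la _ T2_gt0) lround.
  have -> : (T0 + matching_time = (T1 + s * stage_time Q2).+2)%N.
    by rewrite /matching_time /T1 !addnA !addn2.
  move=> I I' e e' eq_view; rewrite !in_setU; congr (_ || _).
    exact: lsel eq_view.
  by rewrite !inE (lempty _ _ _ _ _ _ eq_view).
move=> I PI; have [rank degree a_ge0] := HP I PI; have [proper cb] := cP I PI.
have w_ge0 e : 0 <= @nonempty_weight I e by rewrite /nonempty_weight; case: ifP.
have w_empty e : @iinc I e = set0 -> @nonempty_weight I e = 0.
  by move=> e0; rewrite /nonempty_weight sum1_card e0 cards0.
have Q1E : (2 ^ (2 * m2)).-1.+1 = (Q2.+1 * Q2.+1)%N.
  by rewrite prednK ?expn_gt0 // Q2E -expnD addnn -mul2n.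
have cb' e : (c I e < 2 ^ (2 * m2 * (C * s)))%N.
  apply: leq_trans (cb e) _; rewrite leq_exp2l // /colour_bits -/C -/J.
  apply: leq_trans (_ : C * s <= _)%N; last by rewrite leq_pmull.
  by rewrite leq_mul2l /s /stages; apply/orP; right; lia.
have a1 e f : (0 < overlap (@iinc I) e f)%N ->
    (#|[set t | H1 (c I e) t == H1 (c I f) t]| <= C * s)%N.
  move=> ov; apply: agree1; [exact: cb' | exact: cb' | exact: proper].
have a2 i j : (i < (2 ^ (2 * m2)).-1.+1 * (2 ^ (2 * m2)).-1.+1)%N ->
    (j < (2 ^ (2 * m2)).-1.+1 * (2 ^ (2 * m2)).-1.+1)%N -> i != j ->
    (#|[set t | H2 i t == H2 j t]| <= 4)%N.
  by rewrite !prednK ?expn_gt0 // -expnD addnn -mul2n mulnA mulnC; exact: agree2.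
have small1 : (4 * stages J * (C * s) <= (2 ^ (2 * m2)).-1.+1)%N.
  rewrite Q1E; apply: leq_trans (leq_mul (ltnW Q2_low) (ltnW Q2_low)).
  rewrite -/s; nia.
have small2 : (16 * stages J * 4 <= Q2.+1)%N.
  apply: leq_trans (ltnW Q2_low); rewrite -/s; nia.
split.
  move=> e f; rewrite !in_setU !emptyE => /orP[eM|/eqP -> _ _]; last first.
    by rewrite -setI_eq0 set0I.
  case/orP=> [fM|/eqP -> _]; last by rewrite -setI_eq0 setI0.
  exact: approx_matching_disjoint eM fM.
move=> g [g01 gv]; apply/RleP.
have g_ge0 e : 0 <= g e by apply/RleP; case: (g01 e).
have g_le1 e : g e <= 1 by apply/RleP; case: (g01 e).
have gv' v : \sum_(e | v \in @iinc I e) g e <= 1.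
  by move: (gv v) => /RleP; congr (_ <= _); apply: eq_bigl => e; rewrite inE.
have := approx_matching_weight (fun e => iid (inr e : iV I + iE I)) w_ge0 w_empty J_gt0
  r_gt0 (logsizeP D r) rank degree
  a1 a2 level2 small1 small2 g_ge0 gv'.
rewrite -/(M0 I) => approx.
have -> : Rdiv (Rmult 384^-1 (weight_frac (@ia I) g)) (INR r) =
   (384 * r%:R)^-1 * \sum_e ia e * g e.
  by rewrite RdivE INRE invfM mulrAC.
have -> : weight_set (@ia I) (M0 I :|: empty I) = \sum_(e in M0 I :|: empty I) ia e by [].
(* Both [g] and the approximation factor are at most 1, so the full weight of the empty edges covers
   their share. *)
have ia_split e : ia e = @nonempty_weight I e + (if e \in empty I then ia e else 0).
  by rewrite /nonempty_weight emptyE sum1_card cards_eq0; case: eqP; rewrite ?add0r ?addr0.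
have k_ge0 : 0 <= (384 * r%:R)^-1 :> R by rewrite invr_ge0 mulr_ge0.
have k_le1 : (384 * r%:R)^-1 <= 1 :> R.
  by rewrite invf_le1 ?mulr_gt0 ?ltr0n // -natrM ler1n muln_gt0 r_gt0.
apply: le_trans (_ : (384 * r%:R)^-1 * (\sum_e nonempty_weight e * g e
    + \sum_(e in empty I) ia e) <= _).
  rewrite ler_wpM2l // [X in _ + X]big_mkcond -big_split; apply: ler_sum => e _ /=.
  rewrite {1}ia_split mulrDl lerD2l; case: ifP => _; last by rewrite mul0r.
  by rewrite ler_piMr.
rewrite mulrDr; apply: le_trans (lerD approx (ler_piMl _ k_le1)) _.
  by apply: sumr_ge0.
rewrite [X in X + _ <= _]big_mkcond [X in _ + X <= _]big_mkcond [leRHS]big_mkcond -big_split.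
apply: ler_sum => e _ /=.
rewrite in_setU [leRHS](_ : _ = if (e \in M0 I) || (e \in empty I) then
    nonempty_weight e + (if e \in empty I then ia e else 0) else 0); last by rewrite -ia_split.
case: (e \in M0 I); case: (e \in empty I) => //=; rewrite add0r //.
by rewrite lerDr.
Qed.

End Matching.

(** Here [514 = 2 + 4 * 128] comes from the slot bound [128 * C * s], [36] from [s <= 6 * J], which
    uses [1 < J], and [2404] from [2 * 1200 + 4]. *)
Lemma matching_time_le kappa D r :
  (matching_time kappa D r <=
     (2404 + 514 * 36 * 2 ^ (kappa + 4)) * (logsize D r * logsize D r))%N.
Proof.
have := logsize_gt1 D r; rewrite /matching_time /stage_time /mwu_time /stages.
set J := logsize D r; have C_gt0 : (0 < 2 ^ (kappa + 4))%N by rewrite expn_gt0.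
move: (2 ^ (kappa + 4))%N C_gt0 => C C_gt0 J_gt1.
set s := (2 * J + 8)%N; have s_gt0 : (0 < s)%N by rewrite /s addn_gt0 orbT.
have slots : (2 ^ lg (64 * C * s) <= 128 * C * s)%N.
  apply: leq_trans (exp_lg_le _) _; first by rewrite !muln_gt0 C_gt0 s_gt0.
  by rewrite !mulnA.
rewrite prednK ?expn_gt0 //; move: (2 ^ lg _)%N slots => Q slots.
have sJ : (s <= 6 * J)%N by rewrite /s; lia.
have time1 : (2 + 4 * Q <= 514 * (C * s))%N.
  have : (0 < C * s)%N by rewrite muln_gt0 C_gt0.
  lia.
have time2 : (s * (2 + 4 * Q) <= 514 * 36 * C * (J * J))%N.
  apply: leq_trans (leq_mul (leqnn s) time1) _.
  have -> : (s * (514 * (C * s)) = 514 * C * (s * s))%N by lia.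
  have -> : (514 * 36 * C * (J * J) = 514 * C * (6 * J * (6 * J)))%N by lia.
  by rewrite leq_mul2l leq_mul ?orbT.
have JJ : (0 < J * J)%N by rewrite muln_gt0; lia.
rewrite mulnDl -(mulnA 1200%N); move: (J * J)%N JJ (s * _)%N (514 * 36 * C * _)%N time2.
lia.
Qed.

(** Since [r <= x], the square of [lg r] is at most that of [lg x]; the square of [lg D] is at most
    [x], and the mixed term is absorbed by both. *)
Lemma logsize_sq_le D r x : (r * lg D + lg D * lg D <= x)%N ->
  (logsize D r * logsize D r <= 4 * x * lg x ^ 2)%N.
Proof.
move=> bx; have lgD : (0 < lg D)%N by [].
have lgx : (0 < lg x)%N by [].
have rx : (r <= x)%N.
  by apply: leq_trans bx; apply: leq_trans (leq_addr _ _); rewrite leq_pmulr.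
have lrx := leq_lg rx.
have Dx : (lg D * lg D <= x)%N by apply: leq_trans bx; rewrite leq_addl.
have x_gt0 : (0 < x)%N by apply: leq_trans Dx; rewrite muln_gt0 lgD.
rewrite /logsize expnS expn1; move: (lg r) (lg D) (lg x) lrx Dx lgx => p q l lrx Dx lgx.
have pp : (p * p <= x * (l * l))%N by rewrite (leq_trans (leq_mul lrx lrx)) // leq_pmull.
have qq : (q * q <= x * (l * l))%N by rewrite (leq_trans Dx) // leq_pmulr // muln_gt0 lgx.
have amgm : (2 * (p * q) <= p * p + q * q)%N by have := (nat_Cauchy p q).1; rewrite -!mulnn.
rewrite mulnDl !mulnDr; lia.
Qed.

(** Choice glues the solutions for all [n], [D], [r] into one algorithm, as every node knows these
    parameters. *)
Lemma matching_algorithm kappa (T0 : nat -> nat -> nat -> nat)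
    (P : nat -> nat -> nat -> instance -> Prop) :
  (forall n D r I, P n D r I -> [/\ (0 < r)%N, rank_le (@iinc I) r, maxdeg_le (@iinc I) D &
     forall e, 0 <= @ia I e]) ->
  (forall n D r, exists c : forall I, iE I -> nat, localE n D r (T0 n D r) c /\
     forall I, P n D r I -> proper_colouring (@iinc I) (c I) /\
       forall e, (c I e < 2 ^ colour_bits D r kappa)%N) ->
  exists A : LocalAlgo,
    (forall n D r, la_rounds A n D r = T0 n D r + matching_time kappa D r)%N /\
    forall n D r I, P n D r I ->
      good_output (384^-1 : R) (@iinc I) (@ia I) r
        (run_output (@iinc I) A (@input_of n D r I) (@iid I) (la_rounds A n D r)).
Proof.
move=> HP Hc.
have /choice [M MP] : forall p : nat * nat * nat, exists M : forall I : instance, {set iE I},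
    localE p.1.1 p.1.2 p.2 (T0 p.1.1 p.1.2 p.2 + matching_time kappa p.1.2 p.2)
      (fun I e => e \in M I) /\
    forall I, P p.1.1 p.1.2 p.2 I -> good_output (384^-1 : R) (@iinc I) (@ia I) p.2 (M I).
  move=> [[n D] r] /=; have [r_gt0|r0] := ltnP 0 r.
    apply: (local_matching (P := P n D r) r_gt0 _ (Hc n D r)) => I /HP [] //.
  exists (fun I => set0); split=> [I I' e e' _|I /HP[]]; first by rewrite !inE.
  by rewrite ltnNge r0.
have [A [AT AM]] := @algorithm_of_local
  (fun n D r => (T0 n D r + matching_time kappa D r)%N) (fun n D r => M (n, D, r))
  (fun n D r => (MP (n, D, r)).1).
exists A; split=> // n D r I PI; rewrite AT AM.
exact: (MP (n, D, r)).2.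
Qed.

Local Close Scope ring_scope.

Theorem theorem1p1 :
  exists c : R, Rlt R0 c /\
  forall kappa : nat,
    (* with a good coloring given *)
    (exists (C k : nat) (A : LocalAlgo),
       (forall n D r,
          softO_le C k (la_rounds A n D r) (r * lg D + lg D * lg D)) /\
       (forall (V E : finType) (inc : E -> {set V}) (a : E -> R)
               (n D r : nat) (id : V + E -> nat) (col : V + E -> nat),
          valid_instance kappa inc a n D r id ->
          good_coloring inc kappa r D col ->
          good_output c inc a r
            (run_output inc A (mk_input inc a n D r id (Some col)) id
                        (la_rounds A n D r)))) /\
    (* without a coloring *)
    (exists (C k : nat) (A : LocalAlgo),
       (forall n D r,
          softO_le C k (la_rounds A n D r)
                   (r * lg D + lg D * lg D + logstar n)) /\
       (forall (V E : finType) (inc : E -> {set V}) (a : E -> R)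
               (n D r : nat) (id : V + E -> nat),
          valid_instance kappa inc a n D r id ->
          good_output c inc a r
            (run_output inc A (mk_input inc a n D r id None) id
                        (la_rounds A n D r)))).
Proof.
exists (384^-1 : R)%R; split; first by apply/RltP; rewrite invr_gt0 ltr0n.
move=> kappa.
have [K timeK] : exists K, forall D r,
    matching_time kappa D r <= K * (logsize D r * logsize D r).
  by exists (2404 + 514 * 36 * 2 ^ (kappa + 4)); exact: matching_time_le.
pose valid n D r (I : instance) := valid_instance kappa (@iinc I) (@ia I) n D r (@iid I).
have basic n D r I : valid n D r I -> [/\ 0 < r, rank_le (@iinc I) r,
    maxdeg_le (@iinc I) D & forall e, (0 <= @ia I e)%R].
  case=> r2 [_ [rank [degree [a_ge0 _]]]]; split=> //; first exact: ltnW.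
  by move=> e; apply/RleP.
split.
- pose P n D r I := valid n D r I /\
    exists col, icol I = Some col /\ good_coloring (@iinc I) kappa r D col.
  have [n D r I [/basic]//|n D r|A [AT AM]] := @matching_algorithm kappa (fun _ _ _ => 0) P.
    (* The default 0 arises only without a colouring, which [P] excludes. *)
    exists (fun I e => odflt 0 (ni_color (@input_of n D r I (inr e)))); split.
      exact: (@localE_input n D r nat (fun i => odflt 0 (ni_color i))).
    move=> I [_ [col [colE [bound good]]]].
    have colourE e : odflt 0 (ni_color (@input_of n D r I (inr e))) = col (inr e).
      by rewrite /= colE.
    split=> [e f|e]; rewrite ?colourE.
      rewrite overlap_gt0 -setI_eq0 => /andP[ef /set0Pn[v]].
      rewrite inE => /andP[ve vf]; apply: good; rewrite /dist_le2.
      apply/andP; split; first by apply: contra ef => /eqP[->].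
      by apply/orP; right; apply/existsP; exists (inl v); rewrite /= ve vf.
    apply: leq_trans (bound _) _; apply: leq_trans (_ : (2 ^ logsize D r) ^ kappa <= _).
      have [->|kappa_gt0] := posnP kappa; [by rewrite !expn0 | rewrite leq_exp2r //].
      case: (posnP r) => [->|r_gt0].
        rewrite add0n /logsize; apply: leq_trans (ltnW (ltn_exp_lg D)) _.
        by rewrite leq_exp2l // leq_addl.
      apply: leq_trans (logsizeP D r); rewrite mulnS leq_add2l.
      by rewrite leq_pmull.
    rewrite -expnM leq_exp2l // mulnC /colour_bits leq_mul2r; apply/orP; right.
    by apply: ltnW; apply: leq_trans (ltn_expl _ (ltnSn 1)) _; rewrite leq_exp2l // leq_addr.
  exists (K * 4), 2, A; split=> [n D r|V E inc a n D r id col Hv Hcol].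
    rewrite /softO_le AT add0n; apply: leq_trans (timeK _ _) _.
    by rewrite -!mulnA leq_mul2l mulnA logsize_sq_le ?orbT.
  have id_inj : injective id by case: Hv => _ [_ [_ [_ [_ []]]]].
  apply: (AM n D r (Instance inc a (Some col) id_inj)); split=> //.
  by exists col.
- have [n D r|A [AT AM]] := @matching_algorithm kappa (fun n _ _ => 2 * logstar n) valid basic.
    apply: colour_from_ids => I vI; have [_ rank degree _] := basic _ _ _ _ vI.
    by case: vI => _ [_ [_ [_ [_ [_ idb]]]]]; split.
  (* The summand 2 covers the [2 * logstar n] rounds of colour reduction. *)
  exists (2 + K * 4), 2, A; split=> [n D r|V E inc a n D r id Hv].
    rewrite /softO_le AT; set x := (_ + logstar n).
    rewrite (mulnDl 2) (mulnDl (2 * x)) leq_add //.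
      rewrite -mulnA leq_mul2l /=; apply: leq_trans (_ : _ <= x) _; first exact: leq_addl.
      by rewrite leq_pmulr // expn_gt0.
    apply: leq_trans (timeK _ _) _.
    by rewrite -!mulnA leq_mul2l mulnA logsize_sq_le ?orbT // leq_addr.
  have id_inj : injective id by case: Hv => _ [_ [_ [_ [_ []]]]].
  exact: (AM n D r (Instance inc a None id_inj)).
Qed.
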